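(* Let $p,q,r\in\mathbb{Z}$ and let $\Delta_{p,q,r}=\{x+iy\in\mathbb{C} : x,y\in\mathbb{R},\ px+qy=r\}$. Then the Hausdorff dimension of the intersection $\partial\mathcal{K}\cap\Delta_{p,q,r}$ is never equal to $\mathfrak{s}-1$, where $\mathcal{K}$ is the Knuth Twin Dragon and $\mathfrak{s}$ is the Hausdorff dimension of $\partial\mathcal{K}$.
   Context: Let $\alpha=-1+i$. The Knuth Twin Dragon is the compact set $\mathcal{K}=\left\{\sum_{k=1}^\infty d_k\alpha^{-k} : d_k\in\{0,1\}\right\}\subset\mathbb{C}$, and $\partial\mathcal{K}$ is its topological boundary in $\mathbb{C}$. It is known that the Hausdorff dimension of $\partial\mathcal{K}$ is $\mathfrak{s}=\frac{\log\lambda}{\log\sqrt2}\approx 1.5236$, where $\lambda$ is the real number satisfying $\lambda^3=\lambda^2+2$. *)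

(* Defs.v *)
From HB Require Import structures.
From mathcomp Require Import all_boot all_order all_algebra.
From mathcomp Require Import all_classical all_reals all_analysis.
From mathcomp Require Import complex.
Import Order.TTheory GRing.Theory Num.Theory.
Import numFieldNormedType.Exports.

Set Implicit Arguments.
Unset Strict Implicit.
Unset Printing Implicit Defensive.

Local Open Scope classical_set_scope.
Local Open Scope ring_scope.
Local Open Scope complex_scope.

(* The complex plane is R[i]^o: the field R[i] carries its usual topology only
   through its regular-module alias _^o. *)

Section HausdorffDimension.
Context {R : realType}.
Implicit Types (A : set R[i]^o) (s delta : R).

(* The norm `|z| of R[i] takes its values in R[i]; Normc.normc z is the same
   modulus as an element of R.  The added 0 makes the diameter of set0 equal
   to 0 (ereal_sup set0 is -oo). *)
Definition diameter A : \bar R :=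
  ereal_sup [set x | x = 0%E \/
    exists z w : R[i], [/\ A z, A w & x = (Normc.normc (z - w))%:E]].

(* The case of set0 only matters for s = 0, since 0 `^ 0 = 1. *)
Definition diameter_pow s A : \bar R :=
  if `[< A = set0 >] then 0%E else (diameter A `^ s)%E.

Definition hausdorff_premeasure s delta A : \bar R :=
  ereal_inf [set (\sum_(0 <= k <oo) diameter_pow s (U k))%E | U in
    [set U : (set R[i]^o)^nat |
      (forall k, (diameter (U k) <= delta%:E)%E) /\ A `<=` \bigcup_k U k]].

(* The premeasure increases as delta decreases to 0, so that its limit is the
   supremum. *)
Definition hausdorff_measure s A : \bar R :=
  ereal_sup [set hausdorff_premeasure s delta A | delta in
    [set delta | 0 < delta]].

(* In particular the dimension of set0 is 0. *)
Definition hausdorff_dim A : \bar R :=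
  ereal_inf [set s%:E | s in
    [set s | 0 <= s /\ hausdorff_measure s A = 0%E]].

End HausdorffDimension.

Definition boundary (T : topologicalType) (A : set T) : set T :=
  closure A `\` interior A.

Definition alpha (R : realType) : R[i] := (-1) +i* 1.

Definition twin_dragon (R : realType) : set R[i]^o :=
  [set z | exists d : nat -> bool,
     series (fun k => (d k)%:R * alpha R ^- k.+1 : R[i]^o) @ \oo --> z].

Definition line (R : realType) (p q r : int) : set R[i]^o :=
  [set z : R[i] | p%:~R * complex.Re z + q%:~R * complex.Im z = r%:~R].

Arguments twin_dragon R : clear implicits.
Arguments line R p q r : clear implicits.

(* Main.v *)
Require Import Defs.
From mathcomp Require Import all_boot all_order all_algebra.
From mathcomp Require Import all_classical all_reals all_analysis.
From mathcomp Require Import complex.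
From mathcomp Require Import ring lra zify.
Import Order.TTheory GRing.Theory Num.Theory.
Import numFieldNormedType.Exports.

Set Implicit Arguments.
Unset Strict Implicit.
Unset Printing Implicit Defensive.

Local Open Scope classical_set_scope.
Local Open Scope ring_scope.

(** The idea is arithmetic: every slice of the boundary by a line with integer
    coefficients has dimension log rho / log (sqrt 2) with rho an eigenvalue of
    an integer matrix, hence an algebraic integer, whereas dimension s - 1 would
    force rho = lambda / sqrt 2.  The square mu = lambda ^ 2 / 2 of that number
    is a root of 2 X ^ 3 - X ^ 2 - 2 X - 1, which is irreducible and primitive
    with leading coefficient 2, so mu is not integral
    ([half_square_not_eigenvalue]).

    The integer matrix comes from a finite transition system.  A point z lies on
    the boundary of K exactly when z has an expansion in base alpha and, for
    some Gaussian integer g <> 0, z - g has one too ([boundary_dragonP]): the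
    translates of K cover the plane, and an interior point of K cannot lie in
    K + g, because 0 is the only Gaussian integer in K.  Reading both digit
    sequences at once, the difference g evolves by g -> alpha g + d' - d and
    stays bounded; only six values survive.  The equation of the line, read at
    scale alpha ^ n, keeps integer coefficients and a bounded right-hand side,
    because alpha ^ 2 = - 2 i turns the line by a right angle every two steps.
    So the slice is the set of points coded by the infinite paths of a finite
    graph ([slice_coded]), and the boundary itself is the degenerate slice
    p = q = r = 0.

    The dimension of such a coded set is read off from positive vectors.  If
    w >= 1 satisfies A w <= y w for the transition matrix A, there are O(y ^ n)
    words of length n, and the corresponding cylinders, of diameter
    O(sqrt 2 ^ - n), bound the Hausdorff measures from above
    ([coded_measure_eq0]).  If v >= 0 satisfies A v >= rho v, then v gives words
    a mass, the mass of a cover is at least v s ([mass_cover]), and a set of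
    diameter sqrt 2 ^ - n meets a bounded number of cylinders of level n, since
    distinct words of the same length have distinct Gaussian integer values; this
    is the mass distribution principle ([coded_measure_neq0]).  For the slices, w and v come
    from a weak form of the Perron-Frobenius theorem ([perron]); for the
    boundary, an explicit eigenvector on the six neighbours, with eigenvalue
    lambda, serves as both ([dragon_vector_eigen]). *)

(** * Growth rate of a nonnegative matrix *)

Section Perron.
Variables (R : realType) (n : nat) (i0 : 'I_n) (A : 'M[R]_n).
Hypothesis A_ge0 : forall i j, 0 <= A i j.

(** The set of y that admit such a w is an up-closed open ray; its infimum will be
    the spectral radius. *)
Definition strict_super (y : R) (w : 'cV[R]_n) :=
  (forall i, 0 <= w i 0) /\ forall i, 1 <= y * w i 0 - (A *m w) i 0.

Lemma mulmx_ge0 (w : 'cV[R]_n) :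
  (forall i, 0 <= w i 0) -> forall i, 0 <= (A *m w) i 0.
Proof. by move=> w0 i; rewrite mxE sumr_ge0 // => j _; rewrite mulr_ge0. Qed.

Lemma strict_super_gt0 y w : strict_super y w -> 0 < y /\ forall i, 0 < w i 0.
Proof.
move=> [w0 h].
have yw i : 0 < y * w i 0.
  by have := h i; have := mulmx_ge0 w0 i; lra.
have wi i : 0 < w i 0.
  by rewrite lt_neqAle w0 andbT; apply/eqP => wi0; have := yw i; rewrite -wi0 mulr0 ltxx.
by split=> //; have := yw i0; rewrite pmulr_lgt0.
Qed.

Lemma strict_super_le y z w : y <= z -> strict_super y w -> strict_super z w.
Proof.
move=> yz [w0 h]; split=> // i; have := h i; have : y * w i 0 <= z * w i 0.
  by rewrite ler_wpM2r.
by lra.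
Qed.

(** The maximum principle of M-matrices: were x negative somewhere, then at the
    index where x / w is smallest the inequality of x would contradict that of w. *)
Lemma strict_super_mono y w (x : 'cV[R]_n) : strict_super y w ->
  (forall i, 0 <= y * x i 0 - (A *m x) i 0) -> forall i, 0 <= x i 0.
Proof.
move=> sw hx; have [y0 w0] := strict_super_gt0 sw; case: sw => _ hw.
pose f i := x i 0 / w i 0.
(* f k is the smallest ratio x i / w i *)
have [k _ kmin] := Order.TotalTheory.arg_minP f (erefl : xpredT i0).
have xw i : f k * w i 0 <= x i 0 by rewrite -ler_pdivlMr // kmin.
case: (leP 0 (f k)) => [fk0 i|fk0].
  by apply: le_trans (xw i); rewrite mulr_ge0 // ltW.
have hAx : f k * (A *m w) k 0 <= (A *m x) k 0.
  rewrite !mxE mulr_sumr ler_sum // => j _.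
  by rewrite mulrCA ler_wpM2l.
have xk : x k 0 = f k * w k 0 by rewrite /f divfK // gt_eqF.
have := hx k; rewrite xk; have := hw k.
set a := (A *m w) k 0 in hAx *; set b := (A *m x) k 0 in hAx *; set c := w k 0.
move=> h1 h2; exfalso.
have : f k * (y * c - a) < 0 by rewrite nmulr_rlt0 //; lra.
by rewrite mulrBr mulrCA; lra.
Qed.

Lemma strict_super_exists : exists y w, strict_super y w.
Proof.
pose w : 'cV[R]_n := const_mx 1.
exists (1 + \sum_i (A *m w) i 0), w.
have w0 i : 0 <= w i 0 by rewrite mxE.
split=> // i; rewrite [w i 0]mxE mulr1.
have : (A *m w) i 0 <= \sum_i (A *m w) i 0.
  rewrite (bigD1 i) //= lerDl sumr_ge0 // => j _; exact: mulmx_ge0.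
lra.
Qed.

(** Let rho be the infimum of the y with a strict supersolution.  If rho - A were
    invertible, the solution x of (rho - A) x = 1 would be nonnegative, as
    [strict_super_mono] shows at a slightly larger y, and twice x would be a
    strict supersolution slightly below rho.  The eigenvector need not be
    nonnegative; its absolute value is a subsolution, which is enough for
    lower bounds. *)
Lemma perron : exists rho : R, [/\ 0 <= rho,
    exists2 x : 'cV[R]_n, x != 0 & A *m x = rho *: x
  & forall y, rho < y -> exists2 w : 'cV[R]_n,
      forall i, 1 <= w i 0 & forall i, (A *m w) i 0 <= y * w i 0].
Proof.
pose G := [set y | exists w, strict_super y w].
have G0 : G !=set0 by have [y yG] := strict_super_exists; exists y.
have Glb : lbound G 0 by move=> y [w /strict_super_gt0[/ltW]].
have Ghi : has_inf G by split=> //; exists 0.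
have Ggt y : inf G < y -> G y.
  move=> /(inf_lt G0)[z [w zw] zy]; exists w; exact: strict_super_le (ltW zy) zw.
have rho0 : 0 <= inf G by apply: lb_le_inf.
exists (inf G); set rho := inf G; split=> //; last first.
  move=> y /Ggt[w sw]; have [y0 w0] := strict_super_gt0 sw; case: sw => _ hw.
  exists (y *: w) => i.
    by rewrite mxE; have := hw i; have := mulmx_ge0 (fun i => ltW (w0 i)) i; lra.
  rewrite -scalemxAr !mxE ler_wpM2l ?(ltW y0)//.
  by have := hw i; rewrite mxE; lra.
pose M := rho%:M - A.
have ME x i : (M *m x) i 0 = rho * x i 0 - (A *m x) i 0.
  by rewrite mulmxBl mul_scalar_mx !mxE.
have [Mu|Mnu] := boolP (M \in unitmx); last first.
  have : \det M^T == 0.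
    by move: Mnu; rewrite unitmxE unitfE negbK det_tr.
  case/det0P => v v0 vM; exists v^T.
    by apply: contra v0 => /eqP /(congr1 trmx); rewrite trmxK trmx0 => ->.
  have : M *m v^T = 0 by apply: trmx_inj; rewrite trmx_mul trmxK trmx0.
  by rewrite mulmxBl mul_scalar_mx => /eqP; rewrite subr_eq0 => /eqP <-.
exfalso.
pose x : 'cV[R]_n := invmx M *m const_mx 1.
have Mx i : rho * x i 0 - (A *m x) i 0 = 1.
  by rewrite -ME /x mulKVmx // mxE.
(* e is small enough for e |x i| <= 1 / 2 at all i *)
pose e := (1 + 2 * \sum_i `|x i 0|)^-1.
have S0 : 0 <= \sum_i `|x i 0| by rewrite sumr_ge0.
have e0 : 0 < e by rewrite invr_gt0; lra.
have ex i : e * `|x i 0| <= 2^-1.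
  rewrite /e mulrC ler_pdivrMr; last lra.
  have : `|x i 0| <= \sum_i `|x i 0| by rewrite (bigD1 i) //= lerDl sumr_ge0.
  by lra.
have xge0 : forall i, 0 <= x i 0.
  have [w sw] := Ggt (rho + e) ltac:(lra).
  apply: (strict_super_mono sw) => i; rewrite mulrDl.
  have := Mx i; have := ex i.
  have : - (e * `|x i 0|) <= e * x i 0 by rewrite -mulrN ler_wpM2l ?(ltW e0)// lerNl -normrN ler_norm.
  by lra.
have : G (rho - e).
  exists (2 *: x); split=> i; first by rewrite mxE mulr_ge0.
  rewrite -scalemxAr [X in _ * X]mxE [X in _ - X]mxE mulrCA -mulrBr mulrBl.
  have := Mx i; have := ex i; have := xge0 i => xi0; rewrite ger0_norm //.
  by lra.
move=> /(ge_inf _) => /(_ ltac:(by exists 0)); rewrite -/rho; lra.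
Qed.
End Perron.

(** * Words and mass in a finite transition system *)

Section Automaton.
Variables (R : realType) (T : Type) (E : finType).
Variables (step : T -> E -> T) (live : pred T).

Definition live_word (s : T) (w : seq E) := all live (scanl step s w).

Definition live_path (s : T) (e : nat -> E) :=
  forall n, live_word s (mkseq e n).

Fixpoint live_words (n : nat) (s : T) : seq (seq E) :=
  if n is n'.+1 then
    [seq e :: w | e <- [seq e <- enum E | live (step s e)],
                  w <- live_words n' (step s e)]
  else [:: [::]].

Lemma live_word_rcons s w e :
  live_word s (rcons w e) = live_word s w && live (step (foldl step s w) e).
Proof. by rewrite /live_word scanl_rcons all_rcons foldl_rcons andbC. Qed.

Lemma mem_live_words n s w :
  (w \in live_words n s) = (size w == n) && live_word s w.
Proof.
elim: n s w => [|n IH] s [|e w] //=.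
- by apply/allpairsPdep => -[? [? []]].
- rewrite eqSS /live_word /= andbCA -IH.
  apply/allpairsPdep/andP => [[e' [w' [+ + [-> ->]]]]|[le wi]].
    by rewrite mem_filter => /andP[-> _].
  by exists e, w; split=> //; rewrite mem_filter le mem_enum.
Qed.

Lemma live_words_uniq n s : uniq (live_words n s).
Proof.
elim: n s => [|n IH] s //=.
apply: allpairs_uniq_dep; first by rewrite filter_uniq // enum_uniq.
  by move=> e _; apply: IH.
by move=> [a b] [c d] _ _ /= [-> ->].
Qed.

Lemma big_live_words (V : nmodType) n s (P : pred (seq E)) (F : seq E -> V) :
  \sum_(w <- live_words n.+1 s | P w) F w =
  \sum_(e | live (step s e))
     \sum_(w <- live_words n (step s e) | P (e :: w)) F (e :: w).
Proof.
rewrite /= big_mkcond big_allpairs_dep big_filter big_enum_cond.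
by apply: eq_bigr => e _; rewrite [RHS]big_mkcond.
Qed.

Definition transfer (v : T -> R) (s : T) : R :=
  \sum_(e | live (step s e)) v (step s e).

(** The invariant Q allows the supersolution w to be controlled only on the states
    that can be reached from the starting ones. *)
Lemma size_live_words_le (Q : T -> Prop) (w : T -> R) (y : R) : 0 <= y ->
  (forall s e, Q s -> live (step s e) -> Q (step s e)) ->
  (forall s, Q s -> 1 <= w s) ->
  (forall s, Q s -> transfer w s <= y * w s) ->
  forall n s, Q s -> (size (live_words n s))%:R <= y ^+ n * w s.
Proof.
move=> y0 Qstep w1 wy; elim=> [|n IH] s Qs; first by rewrite mul1r w1.
rewrite -sum1_size natr_sum big_live_words exprSr -mulrA.
apply: le_trans (ler_wpM2l (exprn_ge0 _ y0) (wy _ Qs)).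
rewrite mulr_sumr ler_sum // => e le.
by apply: le_trans (IH _ (Qstep _ _ Qs le)); rewrite -sum1_size natr_sum.
Qed.

(** These vectors yield masses: boundedness gives O(rho ^ - n) for the mass of a word of
    length n, and the last clause makes mass subadditive along transitions. *)
Definition subharmonic (rho : R) (v : T -> R) :=
  [/\ forall s, 0 <= v s, exists B, forall s, v s <= B
    & forall s, live s -> rho * v s <= transfer v s].

Lemma transfer_ge0 v s : (forall t, 0 <= v t) -> 0 <= transfer v s.
Proof. by move=> v0; apply: sumr_ge0. Qed.

Lemma subharmonic_transfer rho v : subharmonic rho v ->
  subharmonic rho (fun s => v s + transfer v s).
Proof.
move=> [v0 [B vB] vs]; split.
- by move=> s; rewrite addr_ge0 ?transfer_ge0.
- have B0 : forall s : T, 0 <= B by move=> s; apply: le_trans (vB s).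
  exists (B + \sum_(e : E) B) => s; rewrite lerD //.
  rewrite /transfer big_mkcond; apply: ler_sum => e _.
  by case: ifP => // _; exact: B0 s.
move=> s ls; rewrite mulrDr /transfer big_split /= lerD ?vs //.
by rewrite mulr_sumr ler_sum // => e le; exact: vs.
Qed.

(** Adding its transfer to a subharmonic vector spreads its support one step
    backwards, so positivity propagates from a state to all states leading to it. *)
Lemma subharmonic_pull rho s w : live_word s w ->
  (exists2 v, subharmonic rho v & 0 < v (foldl step s w)) ->
  exists2 v, subharmonic rho v & 0 < v s.
Proof.
elim: w s => [|e w IH] s //; rewrite /live_word /= => /andP[le lw] vw.
have [v vsub v0] := IH _ lw vw; exists (fun s => v s + transfer v s).
  exact: subharmonic_transfer.
case: (vsub) => vge0 _ _; rewrite ltr_wpDl // /transfer (bigD1 e) //=.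
by rewrite ltr_wpDr // sumr_ge0.
Qed.

Variables (v : T -> R) (rho : R).
Hypothesis v_ge0 : forall s, 0 <= v s.
Hypothesis rho_gt0 : 0 < rho.
Hypothesis v_sub : forall s, live s -> rho * v s <= transfer v s.

(** A substitute for a measure on the infinite paths from s: V stands for the set of the
    paths whose prefix of length n lies in V. *)
Definition mass (s : T) (n : nat) (V : pred (seq E)) : R :=
  rho ^- n * \sum_(w <- live_words n s | V w) v (foldl step s w).

Lemma mass_ge0 s n V : 0 <= mass s n V.
Proof.
by rewrite mulr_ge0 ?invr_ge0 ?exprn_ge0 ?(ltW rho_gt0) // sumr_ge0.
Qed.

Lemma mass0 s V : mass s 0 V = if V [::] then v s else 0.
Proof. by rewrite /mass /= big_mkcond big_seq1 invr1 mul1r. Qed.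

Lemma massS s n V : mass s n.+1 V =
  \sum_(e | live (step s e)) rho^-1 * mass (step s e) n (V \o cons e).
Proof.
rewrite /mass big_live_words exprS invfM -mulrA !mulr_sumr.
by apply: eq_bigr.
Qed.

Lemma mass_le B s n V : (forall t, v t <= B) ->
  mass s n V <= rho ^- n * (B * (count V (live_words n s))%:R).
Proof.
move=> vB; rewrite ler_wpM2l ?invr_ge0 ?exprn_ge0 ?(ltW rho_gt0) //.
rewrite -sum1_count natr_sum mulr_sumr ler_sum // => w _.
by rewrite mulr1.
Qed.

(** Countable subadditivity, without a measure on paths: if the total mass of the
    cover were smaller than v s, then by subharmonicity some transition preserves
    this strict inequality, and following such transitions for ever produces an
    infinite path that no member of the cover contains. *)
Lemma mass_cover s (n : nat -> nat) (V : nat -> pred (seq E)) : live s ->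
  (forall e, live_path s e -> exists k, V k (mkseq e (n k))) ->
  ((v s)%:E <= \sum_(0 <= k <oo) (mass s (n k) (V k))%:E)%E.
Proof.
move=> ls cov; rewrite leNgt; apply/negP => small.
(* the mass of the k-th set among the paths that start with u *)
pose m u k := mass (foldl step s u) (n k - size u)
  (fun w => V k (take (n k) (u ++ w))).
pose good u := live_word s u /\
  (\sum_(0 <= k <oo) (m u k)%:E < (v (foldl step s u))%:E)%E.
have m0 u k : (0 <= (m u k)%:E)%E by rewrite lee_fin mass_ge0.
have good_nil : good [::].
  split=> //=; rewrite (@eq_eseriesr _ _ (fun k => (mass s (n k) (V k))%:E)) // => k _.
  rewrite /m /= subn0; congr _%:E.
  rewrite /mass; congr *%R; rewrite big_seq_cond [RHS]big_seq_cond.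
  apply: eq_bigl => w; rewrite mem_live_words; case: eqP => //= <-.
  by rewrite take_size.
have goodN u k : good u -> (n k <= size u)%N -> ~~ V k (take (n k) u).
  move=> [_ gu] nk; apply/negP => Vk; move: gu; rewrite ltNge => /negP; apply.
  rewrite (nneseriesD1 (n := k) (fun j _ => m0 u j) isT).
  rewrite {1}/m (eqP (_ : n k - size u == 0)%N) ?subn_eq0 //.
  rewrite mass0 cats0 Vk leeDl //.
  by apply: nneseries_ge0 => *; rewrite lee_fin mass_ge0.
have live_last u : good u -> live (foldl step s u).
  by move=> [+ _]; case/lastP: u => // u e; rewrite live_word_rcons foldl_rcons => /andP[].
have mE u k : good u -> m u k =
    \sum_(e | live (step (foldl step s u) e)) rho^-1 * m (rcons u e) k.
  move=> gu; rewrite /m; have [nk|nk] := leqP (n k) (size u).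
    have un : (n k - size u = 0)%N by apply/eqP; rewrite subn_eq0.
    rewrite un mass0 cats0 (negPf (goodN _ _ gu nk)) big1 // => e _.
    rewrite size_rcons subnS un mass0 cats0 -cats1 takel_cat //.
    by rewrite (negPf (goodN _ _ gu nk)) mulr0.
  rewrite -(subnSK nk) massS; apply: eq_bigr => e _.
  rewrite size_rcons foldl_rcons; congr (_ * mass _ _ _).
  by apply/funext => w /=; rewrite cat_rcons.
have goodS u : good u -> exists e, good (rcons u e).
  move=> gu; have lu := live_last _ gu; apply: contrapT => /forallNP ng.
  case: (gu) => lw; rewrite ltNge => /negP; apply.
  rewrite (eq_eseriesr (fun k _ => congr1 EFin (mE u k gu))).
  under eq_eseriesr do rewrite -sumEFin.
  rewrite nneseries_sum; last first.
    by move=> e k _; rewrite lee_fin mulr_ge0 ?invr_ge0 ?(ltW rho_gt0) ?mass_ge0.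
  apply: (@le_trans _ _ (\sum_(e | live (step (foldl step s u) e))
     (rho^-1 * v (step (foldl step s u) e))%:E)%E).
    rewrite sumEFin lee_fin -mulr_sumr mulrC ler_pdivlMr // mulrC.
    exact: v_sub.
  apply: lee_sum => e le.
  under eq_eseriesr do rewrite EFinM.
  rewrite nneseriesZl; last by move=> *; rewrite lee_fin mass_ge0.
  rewrite EFinM lee_wpmul2l ?lee_fin ?invr_ge0 ?(ltW rho_gt0) // leNgt.
  apply/negP => lt; apply: (ng e); split; last by rewrite foldl_rcons.
  by rewrite live_word_rcons lw.
have [f fP] : exists f : seq E -> E, forall u, good u -> good (rcons u (f u)).
  have [e0 _] := goodS _ good_nil.
  suff /choice[f] : forall u, exists e, good u -> good (rcons u e) by exists f.
  move=> u; have [/goodS[e]|ngu] := pselect (good u); first by exists e.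
  by exists e0.
pose w := fix w n := if n is n'.+1 then rcons (w n') (f (w n')) else [::].
have wE k : w k = mkseq (f \o w) k.
  by elim: k => //= k IH; rewrite mkseqS -IH.
have gw k : good (w k) by elim: k => //= k; apply: fP.
have [k Vk] : exists k, V k (mkseq (f \o w) (n k)).
  by apply: cov => k; rewrite -wE; case: (gw k).
have := goodN _ k (gw (n k)); rewrite wE size_mkseq leqnn => /(_ isT).
by rewrite -{1}(size_mkseq (f \o w) (n k)) take_size Vk.
Qed.

End Automaton.

(** * An algebraic number that is not integral *)

Section Arithmetic.

(** The polynomial 2 X ^ 3 - X ^ 2 - 2 X - 1 has no root modulo 3, not even at
    infinity. *)
Lemma cubic_form_anisotropic3 (a b : int) :
  2 * a ^+ 3 - a ^+ 2 * b - 2 * a * b ^+ 2 - b ^+ 3 = 0 ->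
  (3 %| a)%Z && (3 %| b)%Z.
Proof.
move=> h.
have [k [i [Ha Hi]]] : exists k i : int, a = 3 * k + i /\ (i = 0 \/ i = 1 \/ i = 2).
  by exists (a %/ 3)%Z, (a %% 3)%Z; lia.
have [l [j [Hb Hj]]] : exists k i : int, b = 3 * k + i /\ (i = 0 \/ i = 1 \/ i = 2).
  by exists (b %/ 3)%Z, (b %% 3)%Z; lia.
rewrite Ha Hb in h *.
by case: Hi => [->|[->|->]] in h *; case: Hj => [->|[->|->]] in h *; lia.
Qed.

(** If l ^ 3 = l ^ 2 + 2 and mu = l ^ 2 / 2, then l mu = mu + 1; squaring gives
    2 mu ^ 3 = (mu + 1) ^ 2, the equation of this polynomial. *)
Definition half_square_poly : {poly int} := 2%:P * 'X^3 - 'X^2 - 2%:P * 'X - 1.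

Lemma half_square_polyE : half_square_poly = Poly [:: -1; -2; -1; 2].
Proof.
apply/polyP => i; rewrite /half_square_poly coef_Poly !coefE.
by case: i => [|[|[|[|i]]]] //=; rewrite !nth_default.
Qed.

Lemma horner_half_square (F : comNzRingType) (x : F) :
  (map_poly intr half_square_poly).[x] = 2 * x ^+ 3 - x ^+ 2 - 2 * x - 1.
Proof.
rewrite /half_square_poly !(rmorphB, rmorphM, rmorphXn, rmorph1) /= !map_polyC map_polyX.
by rewrite !(hornerD, hornerN, hornerM, hornerXn, hornerC, hornerX).
Qed.

Lemma half_square_poly_irreducible :
  irreducible_poly (map_poly intr half_square_poly : {poly rat}).
Proof.
have pE : half_square_poly = [:: -1; -2; -1; 2] :> seq int.
  by rewrite half_square_polyE (@PolyK _ 0).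
apply: cubic_irreducible.
  by rewrite size_map_inj_poly ?pE //; exact: intr_inj.
move=> x; apply/negP => /rootP; rewrite horner_half_square => h.
have [d0 n0] := (denq_neq0 x, coprime_num_den x).
have nE : (numq x)%:~R = x * (denq x)%:~R :> rat by rewrite numqE.
have /andP[a3 b3] : (3 %| numq x)%Z && (3 %| denq x)%Z.
  apply: cubic_form_anisotropic3; apply: (@intr_inj rat).
  rewrite !(rmorphB, rmorphM, rmorphXn) /= nE; set b := (denq x)%:~R.
  transitivity (b ^+ 3 * (2 * x ^+ 3 - x ^+ 2 - 2 * x - 1)); first by ring.
  by rewrite h mulr0.
by have := dvdz_gcd 3 (numq x) (denq x); rewrite /gcdz a3 b3 (eqP n0).
Qed.

(** By Gauss's lemma the irreducible primitive polynomial of mu divides over the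
    integers every integer polynomial that vanishes at mu; its leading coefficient
    2 cannot divide that of a characteristic polynomial, which is 1. *)
Lemma half_square_not_eigenvalue (F : numFieldType) (mu : F) n
    (B : 'M[int]_n) (x : 'cV[F]_n) :
  2 * mu ^+ 3 - mu ^+ 2 - 2 * mu - 1 = 0 -> x != 0 ->
  map_mx intr B *m x != mu *: x.
Proof.
move=> hmu x0; apply/eqP => Bx.
have q0 : root (map_poly intr half_square_poly) mu.
  by apply/rootP; rewrite horner_half_square.
pose p := char_poly B^T.
have p0 : root (map_poly intr p) mu.
  rewrite map_char_poly -eigenvalue_root_char; apply/eigenvalueP.
  exists x^T; last by apply: contra x0 => /eqP /(congr1 trmx); rewrite trmxK trmx0 => ->.
  by rewrite -map_trmx -trmx_mul Bx linearZ.
have ratrE (r : {poly int}) : map_poly intr r = map_poly ratr (map_poly intr r : {poly rat}) :> {poly F}.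
  by rewrite -map_poly_comp; apply: eq_map_poly => z /=; rewrite ratr_int.
have : map_poly intr half_square_poly %| (map_poly intr p : {poly rat}).
  apply/negPn; rewrite -(irreducible_poly_coprime _ half_square_poly_irreducible).
  apply/negP; rewrite -(coprimep_map (@ratr F)) -!ratrE => /coprimep_root/(_ q0).
  by rewrite (rootP p0) eqxx.
rewrite dvdp_rat_int => /dvdpP_int[r pE].
have := char_poly_monic B^T; rewrite -/p pE monicE lead_coefM => /eqP lr.
have cz i := congr1 (fun f : {poly int} => f`_i) (zpolyEprim half_square_poly).
have := cz 0%N; have := cz 3%N; rewrite !coefZ.
have sz : size half_square_poly = 4%N.
  by rewrite half_square_polyE (@PolyK _ 0).
have -> : (zprimitive half_square_poly)`_3 = lead_coef (zprimitive half_square_poly).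
  by rewrite lead_coefE size_zprimitive sz.
have [-> ->] : half_square_poly`_3 = 2 /\ half_square_poly`_0 = -1.
  by rewrite half_square_polyE (@PolyK _ 0).
move=> h3 h0.
set u := lead_coef _ in lr h3; set c := zcontents _ in h3 h0.
set e := lead_coef _ in lr; set z := _`_0 in h0.
have cu : c \is a GRing.unit by apply/unitrP; exists (- z); split; lia.
have uu : u \is a GRing.unit by apply/unitrP; exists e; split; lia.
have : (2 : int) \is a GRing.unit by rewrite h3 unitrM cu.
by [].
Qed.
End Arithmetic.

(** * Expansions in base alpha *)

Local Open Scope complex_scope.

Section Modulus.
Context {R : realType}.
Local Notation N := (@Normc.normc R).

Lemma normcD_le (x y : R[i]) : N (x + y) <= N x + N y.
Proof. exact: le_normcD. Qed.

Lemma normcB_le (x y : R[i]) : N (x - y) <= N x + N y.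
Proof. by rewrite -(normcN y) normcD_le. Qed.

Lemma normc_ge0 (x : R[i]) : 0 <= N x.
Proof. by case: x => a b; rewrite sqrtr_ge0. Qed.

Lemma normcX (x : R[i]) n : N (x ^+ n) = N x ^+ n.
Proof.
by elim: n => [|n IH]; rewrite ?expr0 ?Normc.normc1 // !exprS Normc.normcM IH.
Qed.

Lemma normRe_le (x : R[i]) : `|complex.Re x| <= N x.
Proof.
case: x => a b /=; rewrite -sqrtr_sqr ler_wsqrtr // lerDl; exact: sqr_ge0.
Qed.

Lemma normIm_le (x : R[i]) : `|complex.Im x| <= N x.
Proof.
case: x => a b /=; rewrite -sqrtr_sqr ler_wsqrtr // lerDr; exact: sqr_ge0.
Qed.

Lemma normc_le_ReIm (x : R[i]) : N x <= `|complex.Re x| + `|complex.Im x|.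
Proof.
case: x => a b /=; rewrite -(ler_pXn2r (n := 2)) ?nnegrE ?sqrtr_ge0 ?addr_ge0 //.
rewrite sqr_sqrtr ?addr_ge0 ?sqr_ge0 // sqrrD !real_normK ?num_real //.
by rewrite lerD2r lerDl mulrn_wge0 // mulr_ge0.
Qed.

(** The norm of the topology is valued in the complex numbers; this and the next
    lemma bring neighbourhoods and limits back to real radii. *)
Lemma nbhs_normcP (z : R[i]^o) (A : set R[i]^o) :
  nbhs z A <-> exists2 e : R, 0 < e & forall w : R[i], N (z - w) < e -> A w.
Proof.
split.
  rewrite -filter_from_norm_nbhs => -[e /= e0 h].
  have [ie re] : complex.Im e = 0 /\ 0 < complex.Re e.
    by move: e0; rewrite ltcE /= => /andP[/eqP].
  exists (complex.Re e) => // w zw; apply: h => /=.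
  by rewrite /ball_ /= ltcE /= ie eqxx.
move=> [e e0 h]; rewrite -filter_from_norm_nbhs; exists e%:C; first by rewrite /= ltcR.
by move=> w /=; rewrite ltcE /= => /andP[_]; exact: h.
Qed.

Lemma cvg_normcP (u : nat -> R[i]) (z : R[i]) :
  ((u : nat -> R[i]^o) @ \oo --> (z : R[i]^o)) <->
  forall e : R, 0 < e -> exists m, forall n, (m <= n)%N -> N (z - u n) < e.
Proof.
split=> [h e e0|h A].
  have /h[m _ hm] : nbhs (z : R[i]^o) [set w : R[i]^o | N (z - w) < e].
    by apply/nbhs_normcP; exists e.
  by exists m => n mn; apply: hm.
move=> /nbhs_normcP[e e0 hA]; have [m hm] := h e e0.
by exists m => // n /= mn; apply/hA/hm.
Qed.

Definition sqrt2 : R := Num.sqrt 2.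

Lemma sqrt2_sqr : sqrt2 ^+ 2 = 2.
Proof. by rewrite sqr_sqrtr. Qed.

Lemma sqrt2_gt0 : 0 < sqrt2.
Proof. by rewrite sqrtr_gt0. Qed.

Lemma sqrt2_bounds : 141 / 100 < sqrt2 < 142 / 100.
Proof. by have := sqrt2_sqr; have := sqrt2_gt0; rewrite expr2; nra. Qed.

Lemma sqrt2_gt1 : 1 < sqrt2.
Proof. by have /andP[] := sqrt2_bounds; lra. Qed.

Lemma normc_alpha : N (alpha R) = sqrt2.
Proof. by rewrite /= sqrrN expr1n. Qed.

Lemma alpha_neq0 : alpha R != 0.
Proof. by rewrite eq_complex /= oner_eq0 andbF. Qed.

Lemma expr_small (q : R) : 0 <= q < 1 -> forall e, 0 < e ->
  exists m, forall n, (m <= n)%N -> q ^+ n < e.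
Proof.
move=> /andP[q0 q1] e e0.
have /cvgr0Pnorm_lt/(_ _ e0)[m _ hm] : q ^+ n @[n --> \oo] --> (0 : R).
  by apply: cvg_expr; rewrite ger0_norm.
by exists m => n /hm /=; apply: le_lt_trans; exact: ler_norm.
Qed.

Lemma sqrt2V_small (e : R) : 0 < e -> exists m, forall n, (m <= n)%N -> sqrt2 ^- n < e.
Proof.
move=> e0; have [|m hm] := @expr_small sqrt2^-1 _ e e0.
  by rewrite invr_ge0 ltW ?sqrt2_gt0 // invf_lt1 ?sqrt2_gt0 ?sqrt2_gt1.
by exists m => n /hm; rewrite exprVn.
Qed.

Definition gaussint := (int * int)%type.

Definition gauss (a : gaussint) : R[i] := a.1%:~R +i* a.2%:~R.

Definition mulalpha (a : gaussint) : gaussint := (- a.1 - a.2, a.1 - a.2).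

Definition digit (b : bool) : gaussint := ((b : nat)%:Z, 0).

Definition wordval (w : seq bool) : gaussint :=
  foldl (fun a b => mulalpha a + digit b) 0 w.

Lemma gaussD a b : gauss (a + b) = gauss a + gauss b.
Proof. by apply/eqP; rewrite eq_complex /= !rmorphD !eqxx. Qed.

Lemma gaussN a : gauss (- a) = - gauss a.
Proof. by apply/eqP; rewrite eq_complex /= !rmorphN !eqxx. Qed.

Lemma gaussB a b : gauss (a - b) = gauss a - gauss b.
Proof. by rewrite gaussD gaussN. Qed.

Lemma gauss0 : gauss 0 = 0.
Proof. by []. Qed.

Lemma gauss_mulalpha a : gauss (mulalpha a) = alpha R * gauss a.
Proof.
by apply/eqP; rewrite eq_complex /= !(rmorphD, rmorphN) /=; apply/andP; split; apply/eqP; ring.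
Qed.

Lemma gauss_digit b : gauss (digit b) = b%:R.
Proof. by case: b. Qed.

Lemma gauss_coord_lt (a : gaussint) (k : nat) : N (gauss a) < k.+1%:R ->
  (`|a.1| <= k)%N && (`|a.2| <= k)%N.
Proof.
move=> h; have := normRe_le (gauss a); have := normIm_le (gauss a).
rewrite /= -!intr_norm => h2 h1.
have /le_lt_trans/(_ h) := h1; have /le_lt_trans/(_ h) := h2.
by rewrite pmulrn !ltr_int; lia.
Qed.

Lemma gauss_inj : injective gauss.
Proof.
move=> [a b] [c d] /eqP; rewrite eq_complex /= !eqr_int => /andP[/eqP-> /eqP->] //.
Qed.

Lemma wordval_rcons w b : wordval (rcons w b) = mulalpha (wordval w) + digit b.
Proof. by rewrite /wordval foldl_rcons. Qed.

Lemma gauss_wordval_cons b w :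
  gauss (wordval (b :: w)) = alpha R ^+ size w * b%:R + gauss (wordval w).
Proof.
elim/last_ind: w => [|w c IH]; first by rewrite mul1r addr0 -gauss_digit.
rewrite -rcons_cons !wordval_rcons !gaussD !gauss_mulalpha IH size_rcons exprS.
by ring.
Qed.

Lemma normc_digit (b : bool) : N (b%:R : R[i]) <= 1.
Proof. by case: b; rewrite ?Normc.normc0 ?Normc.normc1. Qed.

(** The remainder after n digits, rescaled by alpha ^ n: it lies in K when d is an
    expansion of z. *)
Fixpoint tail (d : nat -> bool) (z : R[i]) (n : nat) : R[i] :=
  if n is n'.+1 then alpha R * tail d z n' - (d n')%:R else z.

Lemma tailE d z n : tail d z n = alpha R ^+ n * z - gauss (wordval (mkseq d n)).
Proof.
elim: n => [|n /= ->]; first by rewrite mul1r subr0.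
by rewrite mkseqS wordval_rcons gaussD gauss_mulalpha gauss_digit exprS; ring.
Qed.

Lemma tail_add d z n m : tail d z (n + m) = tail (fun k => d (n + k)%N) (tail d z n) m.
Proof. by elim: m => [|m IH]; rewrite ?addn0 // addnS /= IH. Qed.

(** The sum of the geometric series of ratio 1 / sqrt 2, a bound of the modulus on K. *)
Definition radius : R := 1 + sqrt2.

Lemma radius_lt : radius < 242 / 100.
Proof. by rewrite /radius; have /andP[] := sqrt2_bounds; lra. Qed.

Lemma radius_gt0 : 0 < radius.
Proof. by rewrite /radius; have := sqrt2_gt0; lra. Qed.

(** Bounded tails characterize the convergence of the series of digits to z, see
    [twin_dragonP]. *)
Definition expansion (d : nat -> bool) (z : R[i]) := forall n, N (tail d z n) <= radius.

(** From |u| <= (|alpha u - d| + 1) / sqrt 2, the excess of the tails over the fixed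
    point of the map x -> (x + 1) / sqrt 2 shrinks backwards in time. *)
Lemma tail_back d z n m :
  N (tail d z n) - radius <= sqrt2 ^- m * (N (tail d z (n + m)) - radius).
Proof.
elim: m => [|m IH]; first by rewrite addn0 invr1 mul1r.
apply: le_trans IH _; rewrite exprSr invfM -mulrA ler_wpM2l ?invr_ge0 ?exprn_ge0 ?(ltW sqrt2_gt0) //.
rewrite mulrC ler_pdivlMr ?sqrt2_gt0 // addnS /=.
set u := tail _ _ _.
have : N (alpha R * u) <= N (alpha R * u - (d (n + m)%N)%:R) + 1.
  rewrite -{1}(subrK (d (n + m)%N)%:R (alpha R * u)).
  by apply: le_trans (normcD_le _ _) _; rewrite lerD2l normc_digit.
rewrite Normc.normcM normc_alpha /radius mulrBl.
have := sqrt2_sqr; rewrite expr2 mulrDl => ->; lra.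
Qed.

Lemma tail_le_radius d z n :
  (forall e : R, 0 < e -> exists m, sqrt2 ^- m * N (tail d z (n + m)) < e) ->
  N (tail d z n) <= radius.
Proof.
move=> h; apply/ler_addgt0Pr => e /h[m hm].
rewrite -lerBlDl; apply: le_trans (tail_back d z n m) _; apply: le_trans (ltW hm).
rewrite ler_wpM2l ?invr_ge0 ?exprn_ge0 ?(ltW sqrt2_gt0) //.
by rewrite gerBl ltW // radius_gt0.
Qed.

(** Any bound on the tails improves itself to the sharp one. *)
Lemma bounded_expansion d z (B : R) : (forall n, N (tail d z n) <= B) -> expansion d z.
Proof.
move=> h n; apply: tail_le_radius => e e0.
have B0 : 0 <= B by apply: le_trans (h 0%N); apply: normc_ge0.
have [m hm] := sqrt2V_small (e := e / (B + 1)) ltac:(by rewrite divr_gt0 //; lra).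
exists m; have := hm m (leqnn m); rewrite ltr_pdivlMr; last lra.
apply: le_lt_trans; rewrite ler_wpM2l ?invr_ge0 ?exprn_ge0 ?(ltW sqrt2_gt0) //.
by apply: le_trans (h _) _; lra.
Qed.

Lemma tail_partial_sum d z n :
  tail d z n =
  alpha R ^+ n * (z - series (fun k => (d k)%:R * alpha R ^- k.+1 : R[i]^o) n).
Proof.
elim: n => [|n /= ->]; first by rewrite /series /= big_geq // subr0 mul1r.
rewrite /series /= big_nat_recr //=.
have an : alpha R ^+ n.+1 != 0 by rewrite expf_neq0 // alpha_neq0.
rewrite [in RHS]opprD addrA [in RHS]mulrBr.
congr (_ - _); first by rewrite mulrA -exprS.
by rewrite mulrC -[RHS]mulrA mulVf // mulr1.
Qed.

Lemma twin_dragonP (z : R[i]) : twin_dragon R z <-> exists d, expansion d z.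
Proof.
split=> -[d h]; exists d; last first.
  apply/cvg_normcP => e e0.
  have [m hm] := sqrt2V_small (e := e / (radius + 1)) ltac:(by rewrite divr_gt0 //; have := radius_gt0; lra).
  exists m => n /hm; rewrite ltr_pdivlMr; last by have := radius_gt0; lra.
  apply: le_lt_trans; have := h n; rewrite tail_partial_sum Normc.normcM normcX normc_alpha.
  rewrite -ler_pdivlMl ?exprn_gt0 ?sqrt2_gt0 // => /le_trans; apply.
  rewrite ler_wpM2l ?invr_ge0 ?exprn_ge0 ?(ltW sqrt2_gt0) //; lra.
move=> n; apply: tail_le_radius => e e0.
move/cvg_normcP : h => /(_ (e / sqrt2 ^+ n)); rewrite divr_gt0 ?exprn_gt0 ?sqrt2_gt0 //.
move=> /(_ isT)[m hm]; exists m; have := hm (n + m)%N (leq_addl _ _).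
rewrite tail_partial_sum Normc.normcM normcX normc_alpha ltr_pdivlMr ?exprn_gt0 ?sqrt2_gt0 //.
have sm : sqrt2 ^+ m != 0 :> R by rewrite expf_neq0 // gt_eqF // sqrt2_gt0.
move=> hX; set X := N _ in hX *.
have -> : sqrt2 ^- m * (sqrt2 ^+ (n + m) * X) = X * sqrt2 ^+ n by rewrite exprD; field.
exact: hX.
Qed.

End Modulus.

(** * The boundary of the twin dragon *)

Section GaussArith.

Lemma mulalphaD a b : mulalpha (a + b) = mulalpha a + mulalpha b.
Proof. by case: a b => [a1 a2] [b1 b2]; congr pair; rewrite /=; ring. Qed.

(** The quotient in the division with remainder by alpha, whose residues are 0 and 1
    according to the parity of the sum of the coordinates. *)
Definition divalpha (a : gaussint) : gaussint :=
  let c := a.1 - (odd (absz (a.1 + a.2)) : nat)%:Z in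
  (((a.2 - c) %/ 2)%Z, ((- c - a.2) %/ 2)%Z).

Lemma divalphaE a : a = mulalpha (divalpha a) + digit (odd (absz (a.1 + a.2))).
Proof. case: a => a b; rewrite /divalpha /mulalpha /digit; congr pair; rewrite /=; lia. Qed.

Lemma divalphaK a b : divalpha (mulalpha a + digit b) = a.
Proof.
case: a => x y; rewrite /divalpha /mulalpha /digit /=.
by congr pair; case: b => /=; lia.
Qed.

Lemma mulalpha_digit_inj a b c d : mulalpha a + digit b = mulalpha c + digit d -> a = c /\ b = d.
Proof.
move=> h; have ac : a = c by rewrite -(divalphaK a b) h divalphaK.
by split=> //; move: h; rewrite ac => /addrI; case: b d => [] [].
Qed.

Lemma euclid_alpha n a : exists g w, size w = n /\ a = iter n mulalpha g + wordval w.
Proof.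
elim: n a => [|n IH] a; first by exists a, [::]; rewrite addr0.
have [g [w [sw E]]] := IH (divalpha a).
exists g, (rcons w (odd (absz (a.1 + a.2)))); rewrite size_rcons sw; split=> //.
by rewrite wordval_rcons {1}(divalphaE a) E mulalphaD addrA.
Qed.

Lemma euclid_alpha_uniq n g h w w' : size w = n -> size w' = n ->
  iter n mulalpha g + wordval w = iter n mulalpha h + wordval w' -> g = h /\ w = w'.
Proof.
elim: n w w' => [|n IH] w w'.
  by move=> /size0nil -> /size0nil -> ; rewrite !addr0.
case/lastP: w => // w b; case/lastP: w' => // w' c; rewrite !size_rcons => -[sw] [sw'].
rewrite !wordval_rcons /= !addrA -!mulalphaD => /mulalpha_digit_inj[/(IH _ _ sw sw')[-> ->] ->].
by [].
Qed.

Definition ints (k : nat) : seq int := [seq i%:Z - k%:Z | i <- iota 0 (k + k).+1].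

Lemma mem_ints k (x : int) : (`|x| <= k)%N -> x \in ints k.
Proof.
by move=> h; apply/mapP; exists (absz (x + k%:Z)); rewrite ?mem_iota; lia.
Qed.

Definition box (k : nat) : seq gaussint := [seq (a, b) | a <- ints k, b <- ints k].

Lemma mem_box k a : (`|a.1| <= k)%N && (`|a.2| <= k)%N -> a \in box k.
Proof.
case: a => a b /= /andP[ha hb]; apply/allpairsP; exists (a, b).
by rewrite !mem_ints.
Qed.

(** Small Gaussian integers have finite expansions in base alpha. *)
Lemma divalpha_box2 a : a \in box 2 -> iter 8 divalpha a = 0.
Proof.
have /allP h : all (fun a => iter 8 divalpha a == 0) (box 2) by vm_compute.
by move/h/eqP.
Qed.

End GaussArith.

(** A candidate that fails once fails from then on, so finitely many candidates cannot
    all fail. *)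
Lemma pigeonhole_decreasing (T : eqType) (l : seq T) (P : nat -> T -> Prop) :
  (forall n g, P n.+1 g -> P n g) -> (forall n, exists2 g, g \in l & P n g) ->
  exists2 g, g \in l & forall n, P n g.
Proof.
move=> dec; have le m n g : (m <= n)%N -> P n g -> P m g.
  by move=> /subnK <-; elim: (n - m)%N => // k IH; rewrite addSn => /dec.
elim: l => [|a l IH] h; first by have [] := h 0%N.
have [Pa|/existsNP[m Pa]] := pselect (forall n, P n a).
  by exists a; rewrite ?mem_head.
have [|g gl Pg] := IH; last by exists g => //; rewrite in_cons gl orbT.
move=> n; have [g] := h (maxn m n); rewrite in_cons => /orP[/eqP->|gl] Pg.
  by case: Pa; apply: le Pg; apply: leq_maxl.
by exists g => //; apply: le Pg; apply: leq_maxr.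
Qed.

Section Dragon.
Context {R : realType}.
Local Notation N := (@Normc.normc R).
Local Notation gauss := (@gauss R).
Local Notation radius := (@radius R).
Local Notation sqrt2 := (@sqrt2 R).

Lemma gauss_iter_mulalpha n a : gauss (iter n mulalpha a) = alpha R ^+ n * gauss a.
Proof.
by elim: n => [|n IH] /=; rewrite ?mul1r // gauss_mulalpha IH exprS mulrA.
Qed.

(** A finite version of membership in K at level n.  The constant 3 is larger than the
    bound 1 + sqrt 2 on the tails: this leaves room for small perturbations, and lets
    approximations of level n + 1 truncate to level n. *)
Definition approx (n : nat) (u : R[i]) :=
  exists2 w : seq bool, size w = n & N (alpha R ^+ n * u - gauss (wordval w)) <= 3.

Lemma approx_pred n u : approx n.+1 u -> approx n u.
Proof.
move=> [w]; case/lastP: w => // w b; rewrite size_rcons => -[sw].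
rewrite wordval_rcons gaussD gauss_mulalpha gauss_digit exprS => h; exists w => //.
set x := _ - _; have : N (alpha R * x) <= 3 + 1.
  have -> : alpha R * x =
    alpha R * alpha R ^+ n * u - (alpha R * gauss (wordval w) + b%:R) + b%:R.
    by rewrite /x; ring.
  by apply: le_trans (normcD_le _ _) _; rewrite lerD // normc_digit.
rewrite Normc.normcM normc_alpha; have /andP[] := @sqrt2_bounds R; have := normc_ge0 x.
nra.
Qed.

Lemma approx_le m n u : (m <= n)%N -> approx n u -> approx m u.
Proof. by move=> /subnK <-; elim: (n - m)%N => // k IH; rewrite addSn => /approx_pred. Qed.

Lemma approx_behead n u : approx n.+1 u -> exists b : bool, approx n (alpha R * u - b%:R).
Proof.
move=> [[|b w] // [sw] h]; exists b, w => //; apply: le_trans h.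
by rewrite gauss_wordval_cons sw exprS le_eqVlt; apply/orP; left; apply/eqP; congr N; ring.
Qed.

(** Koenig's lemma on the binary tree of digits: if u is approximable at all
    levels, so is alpha u - d for at least one digit d. *)
Lemma approx_expansion u : (forall n, approx n u) -> exists d, expansion d u.
Proof.
move=> gu; pose good u := forall n, approx n u.
have goodS v : good v -> exists b : bool, good (alpha R * v - b%:R).
  move=> gv; apply: contrapT => /forallNP h.
  have /existsNP[m0 h0] := h false; have /existsNP[m1 h1] := h true.
  have [b hb] := approx_behead (gv (maxn m0 m1).+1).
  by case: b hb => /approx_le => [/(_ m1)|/(_ m0)]; rewrite ?leq_maxr ?leq_maxl => /(_ isT).
have [f fP] : exists f : R[i] -> bool, forall v, good v -> good (alpha R * v - (f v)%:R).
  suff /choice[f] : forall v, exists b : bool, good v -> good (alpha R * v - b%:R) by exists f.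
  move=> v.
  by have [/goodS[b]|ngv] := pselect (good v); [exists b|exists false].
pose v n := iter n (fun v => alpha R * v - (f v)%:R) u.
have gv n : good (v n) by elim: n => //= n; apply: fP.
exists (f \o v); apply: (@bounded_expansion _ _ _ 3) => n.
have -> : tail (f \o v) u n = v n by elim: n => //= n ->.
by have [[|//] _] := gv n 0%N; rewrite mul1r gauss0 subr0.
Qed.

Lemma expansion_approx d z z' n : expansion d z ->
  N (z' - z) * sqrt2 ^+ n <= 2^-1 -> approx n z'.
Proof.
move=> dz zz; exists (mkseq d n); rewrite ?size_mkseq //.
have -> : alpha R ^+ n * z' - gauss (wordval (mkseq d n)) =
   tail d z n + alpha R ^+ n * (z' - z) by rewrite tailE; ring.
apply: le_trans (normcD_le _ _) _; rewrite Normc.normcM normcX normc_alpha mulrC.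
by have := dz n; have := @radius_lt R; lra.
Qed.

Lemma round_gauss (x : R[i]) : exists a, N (x - gauss a) <= 2.
Proof.
exists (Num.floor (complex.Re x), Num.floor (complex.Im x)).
apply: le_trans (normc_le_ReIm _) _; rewrite -[2]/(1 + 1); case: x => x y /=.
have h (t : R) : `|t - (Num.floor t)%:~R| <= 1.
  have := floor_le t; have := floorD1_gt t; rewrite intrD => h1 h2.
  by rewrite ger0_norm; lra.
by rewrite lerD.
Qed.

(** Round alpha ^ n z to a Gaussian integer and divide it n times by alpha. *)
Lemma approx_cover z n : exists g, approx n (z - gauss g).
Proof.
have [a ha] := round_gauss (alpha R ^+ n * z).
have [g [w [sw E]]] := euclid_alpha n a; exists g, w => //.
apply: le_trans (_ : _ <= 2) _; last by lra.
apply: le_trans ha; rewrite E gaussD gauss_iter_mulalpha.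
by rewrite mulrBr opprD addrA.
Qed.

Lemma approx_box z : exists k, forall n g, approx n (z - gauss g) -> g \in box k.
Proof.
exists (Num.bound (N z + 3)) => n g /(approx_le (leq0n n))[[|//] _].
rewrite mul1r gauss0 subr0 => h; apply/mem_box/gauss_coord_lt.
have : N (gauss g) <= N z + 3.
  have -> : gauss g = z - (z - gauss g) by ring.
  by apply: le_trans (normcB_le _ _) _; rewrite lerD2l.
move=> /le_lt_trans; apply; apply: lt_trans (archi_boundP _) _.
  by rewrite addr_ge0 ?normc_ge0.
by rewrite ltr_nat.
Qed.

(** Compactness: only finitely many translations g can occur, so one of them occurs
    at all levels. *)
Lemma approx_limit z (P : gaussint -> Prop) :
  (forall n, exists2 g, P g & approx n (z - gauss g)) ->
  exists2 g, P g & exists d, expansion d (z - gauss g).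
Proof.
move=> h; have [k hk] := approx_box z.
have [||g _ Pg] := @pigeonhole_decreasing _ (box k) (fun n g => P g /\ approx n (z - gauss g)).
- by move=> n g [Pg /approx_pred].
- by move=> n; have [g Pg ag] := h n; exists g => //; apply: hk ag.
by exists g; [case: (Pg 0%N)|apply: approx_expansion => n; case: (Pg n)].
Qed.

Lemma dragon_cover z : exists g d, expansion d (z - gauss g).
Proof.
have [|g _ [d dg]] := @approx_limit z (fun=> True); last by exists g, d.
by move=> n; have [g ag] := approx_cover z n; exists g.
Qed.

(** The opposites of the tails of a Gaussian integer of K are successive preimages
    under the division by alpha, and eight divisions annihilate every Gaussian
    integer as small as these tails. *)
Lemma expansion_gauss_eq0 d a : expansion d (gauss a) -> a = 0.
Proof.
move=> da.
pose h n := iter n mulalpha a - wordval (mkseq d n).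
have hE n : gauss (h n) = tail d (gauss a) n.
  by rewrite tailE gaussB gauss_iter_mulalpha.
have hS n : h n = - divalpha (- h n.+1).
  rewrite -[LHS]opprK -[in LHS](divalphaK (- h n) (d n)); congr (- divalpha _).
  apply: (@gauss_inj R); rewrite gaussD gauss_mulalpha gauss_digit !gaussN !hE /=; ring.
have hb n : - h n \in box 2.
  apply/mem_box/(@gauss_coord_lt R); rewrite gaussN normcN hE.
  by apply: le_lt_trans (da n) _; have := @radius_lt R; lra.
have hi n : h 0%N = - iter n divalpha (- h n).
  elim: n => [|n ->]; first by rewrite opprK.
  by rewrite iterSr [in LHS]hS opprK.
have := hi 8%N; rewrite (divalpha_box2 (hb _)) oppr0.
by rewrite /h /= subr0.
Qed.

(** A boundary point of K is a limit of points outside K, which lie in finitely many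
    translates K + g.  Conversely, if an interior point z of K lies in K + g, then the
    truncations of its expansion in K + g lie in K; multiplied by alpha ^ n they are
    Gaussian integers, so uniqueness of the division by alpha ^ n forces g = 0. *)
Lemma boundary_dragonP (z : R[i]) : boundary (twin_dragon R) z <->
  exists g d d', [/\ g != 0, expansion d z & expansion d' (z - gauss g)].
Proof.
split.
- move=> [clz niz].
  have [d dz] : exists d, expansion d z.
    apply: approx_expansion => n.
    have [z' [/twin_dragonP[d dz']] zz'] : exists z', twin_dragon R z' /\ N (z - z') < 2^-1 / sqrt2 ^+ n.
      have [|z' []] := clz [set w | N (z - w) < 2^-1 / sqrt2 ^+ n]; last by move=> *; exists z'.
      by apply/nbhs_normcP; exists (2^-1 / sqrt2 ^+ n); rewrite // divr_gt0 ?exprn_gt0 ?sqrt2_gt0.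
    apply: (expansion_approx dz'); rewrite -ler_pdivlMr ?exprn_gt0 ?sqrt2_gt0 //.
    exact: ltW.
  have [n|g g0 [d' dg]] := @approx_limit z (fun g => g != 0); last by exists g, d, d'.
  have [z' zz' nz'] : exists2 z', N (z - z') < 2^-1 / sqrt2 ^+ n & ~ twin_dragon R z'.
    apply: contrapT => /forall2NP h; apply: niz; apply/nbhs_normcP.
    exists (2^-1 / sqrt2 ^+ n); first by rewrite divr_gt0 ?exprn_gt0 ?sqrt2_gt0.
    by move=> w zw; have [|/contrapT] := h w.
  have [g [d' dg]] := dragon_cover z'; exists g.
    apply/eqP => g0; apply: nz'; apply/twin_dragonP; exists d'.
    by move: dg; rewrite g0 gauss0 subr0.
  apply: (expansion_approx dg); rewrite -ler_pdivlMr ?exprn_gt0 ?sqrt2_gt0 //.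
  by apply: ltW; have -> : z - gauss g - (z' - gauss g) = z - z' by ring.
move=> [g [d [d' [g0 dz dg]]]]; split.
  by apply: subset_closure; apply/twin_dragonP; exists d.
move=> /nbhs_normcP[e e0 he].
have [m hm] := sqrt2V_small (R := R) (e := e / (radius + 1)) ltac:(by rewrite divr_gt0 //; have := @radius_gt0 R; lra).
have := hm m (leqnn m); rewrite ltr_pdivlMr; last by have := @radius_gt0 R; lra.
move=> hme.
pose b := iter m mulalpha g + wordval (mkseq d' m).
have am : alpha R ^+ m != 0 by rewrite expf_neq0 // alpha_neq0.
have zb : z - gauss b / alpha R ^+ m = tail d' (z - gauss g) m / alpha R ^+ m.
  by rewrite tailE /b gaussD gauss_iter_mulalpha; field.
have /he/twin_dragonP[d2 dw] : N (z - gauss b / alpha R ^+ m) < e.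
  rewrite zb Normc.normcM Normc.normcV normcX normc_alpha mulrC.
  apply: le_lt_trans hme; rewrite ler_wpM2l ?invr_ge0 ?exprn_ge0 ?(ltW sqrt2_gt0) //.
  by apply: le_trans (dg m) _; lra.
have hz : expansion (fun k => d2 (m + k)%N) (gauss (b - wordval (mkseq d2 m))).
  move=> n; have := dw (m + n)%N; rewrite tail_add [tail d2 _ m]tailE gaussB.
  by rewrite mulrCA divff // mulr1.
move: hz => /expansion_gauss_eq0/eqP; rewrite subr_eq0 /b => /eqP.
rewrite -[RHS]add0r -{1}(_ : iter m mulalpha 0 = 0); last by elim: m {am zb hme hm b dw} => //= m ->.
move=> /(euclid_alpha_uniq (size_mkseq _ _) (size_mkseq _ _))[ge _].
by rewrite ge eqxx in g0.
Qed.

End Dragon.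

(** * Slices of the boundary as a transition system *)

Definition label := (bool * bool)%type.

(** If z has digits d and z - g has digits d', this is the difference of the two
    tails after one more pair of digits e = (d, d'). *)
Definition gstep (g : gaussint) (e : label) : gaussint := mulalpha g + digit e.2 - digit e.1.

(** All other nonzero differences leave the window within nine steps. *)
Definition neighbours : seq gaussint :=
  [:: (0, 1); (0, -1); (1, 0); (-1, 0); (1, 1); (-1, -1)].

Definition in_window (g : gaussint) : bool := (`|g.1| <= 4)%N && (`|g.2| <= 4)%N.

Fixpoint survives (n : nat) (g : gaussint) : bool :=
  if in_window g then
    if n is n'.+1 then
      has (fun e => survives n' (gstep g e))
        [:: (false, false); (false, true); (true, false); (true, true)]
    else true
  else false.

Lemma survives_box n g : survives n g -> g \in box 4.
Proof. by case: n => [|n] /=; case: ifP => // /mem_box. Qed.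

Lemma survives9 g : g != 0 -> survives 9 g -> g \in neighbours.
Proof.
have h : all (fun g => (g != 0) ==> survives 9 g ==> (g \in neighbours)) (box 4).
  by vm_compute.
move=> g0 sg; have := allP h _ (survives_box sg).
rewrite g0 sg; exact: id.
Qed.

Lemma gstep_neq0 g e : g != 0 -> gstep g e != 0.
Proof.
apply: contra; rewrite /gstep subr_eq0 -[X in _ == X]add0r -[0 in X in _ == X]/(mulalpha 0).
by move/eqP/mulalpha_digit_inj => [->].
Qed.

Lemma bounded_neighbour (e : nat -> label) (g : nat -> gaussint) :
  (forall n, g n.+1 = gstep (g n) (e n)) -> g 0%N != 0 ->
  (forall n, in_window (g n)) -> forall n, g n \in neighbours.
Proof.
move=> gS g0 gb n; apply: survives9.
  by elim: n => // n; rewrite gS; apply: gstep_neq0.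
elim: 9%N n => [|k IH] n; rewrite /= gb //.
have := IH n.+1; rewrite gS /=; case: (e n) => -[] [] -> ; rewrite ?orbT //.
Qed.

(** A quadruple (g, b, c, r): g is the difference of the two tails, and the tail lies
    on the line p x + q y = r, or - (p + q) x + (p - q) y = r when the flag b is set,
    where c = (p, q).  The flag marks the odd steps, where the coefficients p - q i
    have been multiplied by the conjugate of alpha; two steps multiply them by 2 i,
    and the factor 2 is divided out. *)
Definition state := (gaussint * bool * gaussint * int)%type.

Definition start (p q r : int) (g : gaussint) : state := (g, false, (p, q), r).

Definition step (s : state) (e : label) : state :=
  let: (g, b, c, r) := s in
  if b then (gstep g e, false, (c.2, - c.1), r - c.2 * (e.1 : nat)%:Z)
  else (gstep g e, true, c, 2 * r + (c.1 + c.2) * (e.1 : nat)%:Z).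

Definition live (m : nat) : pred state := fun s =>
  let: (g, b, c, r) := s in
  [&& g \in neighbours, (`|c.1| + `|c.2| <= m)%N & (`|r| <= 6 * m)%N].

Definition live_states (m : nat) : seq state :=
  [seq (x, r) | x <- [seq (y, c) | y <- [seq (g, b) | g <- neighbours, b <- [:: true; false]],
                               c <- box m],
                r <- ints (6 * m)].

Lemma mem_live_states m s : live m s -> s \in live_states m.
Proof.
case: s => [[[g b] c] r] /and3P[hg hc hr].
apply: (allpairs_f (fun x r => (x, r))); last exact: mem_ints.
apply: (allpairs_f (fun x c => (x, c))); last by apply: mem_box; lia.
by apply: (allpairs_f (fun g b => (g, b))); case: (b).
Qed.

Lemma step_g s e : (step s e).1.1.1 = gstep s.1.1.1 e.
Proof. by case: s => [[[g []] c] r]. Qed.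

Lemma run_g s w : (foldl step s w).1.1.1 =
  iter (size w) mulalpha s.1.1.1 + wordval [seq e.2 | e <- w] - wordval [seq e.1 | e <- w].
Proof.
elim/last_ind: w => [|w e IH]; first by rewrite /= subr0 addr0.
rewrite foldl_rcons step_g IH size_rcons !map_rcons !wordval_rcons /gstep.
rewrite !mulalphaD /= !opprD.
have -> : mulalpha (- wordval [seq e.1 | e <- w]) = - mulalpha (wordval [seq e.1 | e <- w]).
  by case: wordval => a b; congr pair => /=; ring.
by rewrite !addrA; congr (_ - _); rewrite addrAC.
Qed.

(** Both digit sequences of a word are determined by their Gaussian integer values:
    the first one is close to that of a reference word, and the second one differs
    from it by the final neighbour g up to a term that depends on s and n alone. *)
Lemma live_words_separated {R : realType} m s n (P : seq (seq label)) :
  live m s -> uniq P ->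
  {in P, forall w, size w = n /\ live_word step (live m) s w} ->
  {in P &, forall w w', Normc.normc
     (@gauss R (wordval [seq e.1 | e <- w]) - gauss (wordval [seq e.1 | e <- w'])) <= 6} ->
  (size P <= size (box 6) * size neighbours)%N.
Proof.
move=> ls uP hP hN; case: P uP hP hN => [|w0 P'] //; set P := _ :: P' => uP hP hN.
(* injective on P, with values in a finite set that does not depend on n *)
pose f (w : seq label) :=
  (wordval [seq e.1 | e <- w] - wordval [seq e.1 | e <- w0], (foldl step s w).1.1.1).
have f_inj : {in P &, injective f}.
  move=> w w' wP w'P; have [sw _] := hP _ wP; have [sw' _] := hP _ w'P.
  rewrite /f !run_g sw sw' => /eqP; rewrite xpair_eqE => /andP[].
  rewrite (inj_eq (addIr _)) => /eqP E1; rewrite E1 (inj_eq (addIr _)).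
  rewrite (inj_eq (addrI _)) => /eqP E2.
  have [||//|_ {}E1] := @euclid_alpha_uniq n 0 0 [seq e.1 | e <- w] [seq e.1 | e <- w'].
  - by rewrite size_map.
  - by rewrite size_map.
  - by rewrite E1.
  have [||//|_ {}E2] := @euclid_alpha_uniq n 0 0 [seq e.2 | e <- w] [seq e.2 | e <- w'].
  - by rewrite size_map.
  - by rewrite size_map.
  - by rewrite E2.
  rewrite -[w]zip_unzip -[w']zip_unzip; congr zip; [exact: E1|exact: E2].
rewrite -(size_map f) -(size_allpairs (fun x y => (x, y)));
  apply: (@uniq_leq_size _ _ [seq (x, y) | x <- box 6, y <- neighbours]).
  by rewrite map_inj_in_uniq.
move=> _ /mapP[w wP ->]; rewrite [f w]surjective_pairing; apply: (allpairs_f (fun x y => (x, y))).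
  apply/mem_box/(@gauss_coord_lt R); rewrite gaussB.
  by apply: le_lt_trans (hN _ _ wP _) _; rewrite ?mem_head // ltr_nat.
have [_] := hP _ wP; case/lastP: w wP => [|w e] wP /=.
  by move=> _; move: ls; case: (s) => [[[g b] c] r] /= /andP[].
rewrite live_word_rcons foldl_rcons => /andP[_].
by case: (step _ _) => [[[g b] c] r] /= /andP[].
Qed.

Section Slices.
Context {R : realType}.
Local Notation N := (@Normc.normc R).
Local Notation gauss := (@gauss R).

Definition form (b : bool) (c : gaussint) (z : R[i]) : R :=
  if b then - (c.1 + c.2)%:~R * complex.Re z + (c.1 - c.2)%:~R * complex.Im z
  else c.1%:~R * complex.Re z + c.2%:~R * complex.Im z.

Lemma form_le b c z (m : nat) : (`|c.1| + `|c.2| <= m)%N ->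
  `|form b c z| <= 2 * m%:R * N z.
Proof.
case: c => p q /= hc.
have hx := normRe_le z; have hy := normIm_le z.
set x := complex.Re z in hx *; set y := complex.Im z in hy *.
have hm : `|p%:~R| + `|q%:~R| <= m%:R :> R.
  by rewrite -!intr_norm -intrD pmulrn ler_int; lia.
have m0 : 0 <= m%:R :> R by [].
have N0 := normc_ge0 z.
have bd (a b' : R) : `|a| <= m%:R -> `|b'| <= m%:R -> `|a * x + b' * y| <= 2 * m%:R * N z.
  move=> ha hb; apply: le_trans (ler_normD _ _) _; rewrite !normrM mulrAC mulrDl mul1r mulrDl.
  by apply: lerD; rewrite [N z * _]mulrC ler_pM.
have := normr_ge0 (p%:~R : R); have := normr_ge0 (q%:~R : R) => q0 p0.
rewrite /form /=; case: b; apply: bd.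
- rewrite normrN intrD; apply: le_trans (ler_normD _ _) _; lra.
- rewrite intrB; apply: le_trans (ler_normB _ _) _; lra.
- lra.
- lra.
Qed.

Definition on_form (s : state) (z : R[i]) := form s.1.1.2 s.1.2 z - s.2%:~R.

(** The equation is doubled by the steps that set the flag and unchanged by the others,
    so a nonzero defect grows geometrically along every path. *)
Lemma on_form_step s z e :
  on_form (step s e) (alpha R * z - e.1%:R) =
  (if s.1.1.2 then 1 else 2) * on_form s z.
Proof.
case: s => [[[g b] [p q]] r]; rewrite /on_form /form /step; case: z => x y.
by case: e => [[] d']; case: b; rewrite /= !(rmorphD, rmorphM, rmorphN) /=; ring.
Qed.

Definition run (s : state) (e : nat -> label) n := foldl step s (mkseq e n).

Lemma runS s e n : run s e n.+1 = step (run s e n) (e n).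
Proof. by rewrite /run mkseqS foldl_rcons. Qed.

Lemma live_pathP m s e : live m s -> (live_path step (live m) s e <->
  forall n, live m (run s e n)).
Proof.
move=> ls; split=> h; last first.
  move=> n; elim: n => // n IH.
  by rewrite mkseqS live_word_rcons IH; have := h n.+1; rewrite runS.
by case=> // n; have := h n.+1; rewrite mkseqS live_word_rcons -/(run _ _ _) -runS => /andP[].
Qed.

(** Liveness bounds both g and r.  This forces z - g to lie in K and z to lie on the
    line, because any defect would grow geometrically. *)
Definition coded (m : nat) (s : state) : set R[i]^o :=
  [set z | live m s /\ exists e : nat -> label,
     live_path step (live m) s e /\ expansion (fun n => (e n).1) z].

Lemma run_tails s e (z : R[i]) n :
  gauss (run s e n).1.1.1 =
  tail (fun n => (e n).1) z n - tail (fun n => (e n).2) (z - gauss s.1.1.1) n.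
Proof.
elim: n => [|n IH]; first by rewrite /run /=; ring.
rewrite runS step_g /gstep gaussB gaussD gauss_mulalpha IH !gauss_digit /=; ring.
Qed.

Lemma run_flag s e n : (run s e n).1.1.2 = s.1.1.2 (+) odd n.
Proof.
elim: n => [|n IH]; first by rewrite /run /= addbF.
rewrite runS; case: (run s e n) IH => [[[g b] c] r] /= ->.
by case: (s.1.1.2); case: (odd n).
Qed.

Lemma run_c s e n :
  (`|(run s e n).1.2.1| + `|(run s e n).1.2.2| = `|s.1.2.1| + `|s.1.2.2|)%N.
Proof.
elim: n => // n <-; rewrite runS.
by case: (run s e n) => [[[g []] c] r] //=; rewrite abszN addnC.
Qed.

Lemma run_on_form s e (z : R[i]) n : on_form s z = 0 ->
  on_form (run s e n) (tail (fun n => (e n).1) z n) = 0.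
Proof. by move=> h; elim: n => // n IH; rewrite runS /= on_form_step IH mulr0. Qed.

Lemma run_on_form_double s e (z : R[i]) k : s.1.1.2 = false ->
  on_form (run s e k.*2) (tail (fun n => (e n).1) z k.*2) = 2 ^+ k * on_form s z.
Proof.
move=> sf; elim: k => [|k IH]; first by rewrite mul1r.
rewrite doubleS 2!runS /= 2!on_form_step -runS !run_flag sf /= odd_double /=.
by rewrite IH mul1r exprS mulrA.
Qed.

Lemma normr_le_geometric_eq0 (x B : R) : (forall k, 2 ^+ k * `|x| <= B) -> x = 0.
Proof.
move=> h; apply/eqP/negPn/negP => x0.
have xp : 0 < `|x| by rewrite normr_gt0.
have B0 : 0 <= B by apply: le_trans (h 0%N); rewrite mul1r.
have := archi_boundP (divr_ge0 B0 (ltW xp)); set k := Num.bound _.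
rewrite ltr_pdivrMr // ltNge => /negP; apply; apply: le_trans (h k).
rewrite ler_wpM2r // -natrX ler_nat; apply: ltnW; exact: ltn_expl.
Qed.

(** From left to right, the tails of z and z - g are bounded, which bounds g and r.
    From right to left, bounded g makes the second tails bounded, and bounded r
    excludes any defect in the equation of the line. *)
Lemma slice_coded (p q r : int) (z : R[i]) :
  (boundary (twin_dragon R) `&` line R p q r) z <->
  exists2 g, g \in neighbours & coded (`|p| + `|q|) (start p q r g) z.
Proof.
set m := (`|p| + `|q|)%N.
have lineE g : line R p q r z <-> on_form (start p q r g) z = 0.
  by rewrite /line /on_form /form /=; split=> [->|/eqP]; rewrite ?subrr // subr_eq0 => /eqP.
have mle s e n : s.1.2 = (p, q) -> (`|(run s e n).1.2.1| + `|(run s e n).1.2.2| <= m)%N.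
  by move=> sc; rewrite run_c sc.
have m0 : 0 <= m%:R :> R by [].
split=> [[/boundary_dragonP[g [d [d' [g0 dz dg]]]] /lineE lz]|[g gn [ls [e [pe dz]]]]].
  pose e n := (d n, d' n); pose s := start p q r g.
  have lr n : live m (run s e n).
    have : (run s e n).1.1.1 \in neighbours.
      apply: (@bounded_neighbour e (fun n => (run s e n).1.1.1)) => // {}n.
        by rewrite runS step_g.
      apply/(@gauss_coord_lt R); rewrite (run_tails _ _ z).
      apply: le_lt_trans (normcB_le _ _) _; have := dz n; have := dg n.
      by have := @radius_lt R; rewrite /e /=; lra.
    have := mle s e n erefl.
    have := run_on_form e n (lz g); rewrite /on_form.
    case: (run s e n) => [[[g' b] c] r'] /= /eqP; rewrite subr_eq0 => /eqP fr cm -> /=.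
    rewrite cm; have := form_le b (tail d z n) cm; rewrite fr -intr_norm => h.
    have : (`|r'|%:~R : R) <= (6 * m)%:R.
      apply: le_trans h _; rewrite natrM; have := dz n; have := @radius_lt R.
      by rewrite /e /= => k1 k2; nra.
    by rewrite pmulrn ler_int; lia.
  exists g; first by have /and3P[] := lr 0%N.
  split; first exact: (lr 0%N).
  by exists e; split=> //; apply/live_pathP => //; exact: (lr 0%N).
have /(live_pathP _ ls) lr := pe.
split; last first.
  apply/(lineE g); apply: (@normr_le_geometric_eq0 _ (2 * m%:R * radius + 6 * m%:R)) => k.
  rewrite -[2 ^+ k]ger0_norm ?exprn_ge0 // -normrM -(run_on_form_double e) //.
  have := mle (start p q r g) e k.*2 erefl; have := lr k.*2; rewrite /on_form.
  case: (run _ _ _) => [[[g' b] c] r'] /= /and3P[_ _ hr] cm.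
  apply: le_trans (ler_normB _ _) _; apply: lerD.
    by apply: le_trans (form_le _ _ cm) _; rewrite ler_wpM2l ?mulr_ge0.
  by rewrite -intr_norm -natrM pmulrn ler_int; lia.
apply/boundary_dragonP; exists g, (fun n => (e n).1), (fun n => (e n).2); split=> //.
  by apply/eqP => g0; move: gn; rewrite g0.
apply: (@bounded_expansion _ _ _ (radius + 2)) => n.
have -> : tail (fun n => (e n).2) (z - gauss g) n =
    tail (fun n => (e n).1) z n - gauss (run (start p q r g) e n).1.1.1.
  by rewrite (run_tails _ _ z) /=; ring.
apply: le_trans (normcB_le _ _) _; apply: lerD; first exact: dz.
apply: le_trans (normc_le_ReIm _) _.
case: (run _ _ _) (lr n) => [[[g' b] c] r'] /= /and3P[gn' _ _].
rewrite -!intr_norm -intrD (_ : 2 = 2%:~R) // ler_int.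
have /allP/(_ _ gn') : all (fun g : gaussint => `|g.1| + `|g.2| <= 2) neighbours by [].
by [].
Qed.
End Slices.

(** * Elementary bounds for Hausdorff measures *)

Section HausdorffBounds.
Context {R : realType}.
Local Notation N := (@Normc.normc R).
Local Notation sqrt2 := (@sqrt2 R).
Local Notation radius := (@radius R).
Local Notation gauss := (@gauss R).
Implicit Types (A U : set R[i]^o).

Lemma diameter_ge0 U : (0 <= diameter U)%E.
Proof. by apply: ereal_sup_ubound; left. Qed.

Lemma diameter_le U (B : R) : 0 <= B ->
  (forall z w : R[i], U z -> U w -> N (z - w) <= B) -> (diameter U <= B%:E)%E.
Proof.
move=> B0 h; apply: ge_ereal_sup => x [->|[z [w [Uz Uw ->]]]]; rewrite lee_fin //.
exact: h.
Qed.

Lemma normc_le_diameter U (B : R) (z w : R[i]) : (diameter U <= B%:E)%E ->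
  U z -> U w -> N (z - w) <= fine (diameter U).
Proof.
move=> dU Uz Uw; rewrite -lee_fin fineK.
  by apply: ereal_sup_ubound; right; exists z, w.
by rewrite ge0_fin_numE ?diameter_ge0 //; apply: le_lt_trans dU _; rewrite ltry.
Qed.

Lemma diameter_pow_ge0 t U : (0 <= diameter_pow t U)%E.
Proof. by rewrite /diameter_pow; case: asboolP => // _; exact: poweR_ge0. Qed.

Lemma diameter_pow_le t U (B : R) : 0 <= t -> 0 <= B -> (diameter U <= B%:E)%E ->
  (diameter_pow t U <= (B `^ t)%:E)%E.
Proof.
move=> t0 B0 dU; rewrite /diameter_pow; case: asboolP => _.
  by rewrite lee_fin powR_ge0.
rewrite -poweR_EFin; apply: gt0_ler_poweR => //.
  by rewrite in_itv /= diameter_ge0 leey.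
by rewrite in_itv /= lee_fin B0 leey.
Qed.

Lemma hausdorff_premeasure_ge0 t delta A : (0 <= hausdorff_premeasure t delta A)%E.
Proof.
apply: le_ereal_inf_tmp => _ [U _ <-]; apply: nneseries_ge0 => k _ _.
exact: diameter_pow_ge0.
Qed.

Lemma hausdorff_premeasure_le_cover (I : eqType) t delta A (B : R) (L : seq I)
    (F : I -> set R[i]^o) : 0 <= t -> 0 <= B -> B <= delta ->
  A `<=` [set z | exists2 i, i \in L & F i z] ->
  (forall i, (diameter (F i) <= B%:E)%E) ->
  (hausdorff_premeasure t delta A <= ((size L)%:R * B `^ t)%:E)%E.
Proof.
move=> t0 B0 Bd AL hL.
pose U k := nth set0 [seq F i | i <- L] k.
have UL k : (k < size L)%N -> exists i, U k = F i.
  case: L {AL} @U => // i0 L U kL; exists (nth i0 (i0 :: L) k).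
  by rewrite /U (nth_map i0).
have U0 k : (size L <= k)%N -> U k = set0 by move=> h; rewrite /U nth_default // size_map.
have dU k : (diameter (U k) <= B%:E)%E.
  have [/U0 ->|/UL[i ->] //] := leqP (size L) k.
  by apply: diameter_le.
apply: ge_ereal_inf; eexists.
  exists U; last reflexivity.
  split=> [k|z /AL[i iL Fz]]; first by apply: le_trans (dU k) _; rewrite lee_fin.
  exists (index i L) => //.
  by rewrite /U (nth_map i) ?index_mem // nth_index.
rewrite (nneseries_split 0 (size L)); last by move=> k _; exact: diameter_pow_ge0.
rewrite add0n [X in (_ + X)%E]eseries0 ?adde0; last first.
  by move=> k /U0 -> _; rewrite /diameter_pow; case: asboolP.
apply: (@le_trans _ _ (\sum_(0 <= k < size L) (B `^ t)%:E)%E).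
  by apply: lee_sum => k _; apply: diameter_pow_le.
by rewrite sumEFin sumr_const_nat subn0 mulr_natl.
Qed.

Lemma hausdorff_measure_eq0 (I : eqType) t A (L : nat -> seq I)
    (F : nat -> I -> set R[i]^o) (b : R) : 0 <= t -> 0 <= b ->
  (forall n, A `<=` [set z | exists2 i, i \in L n & F n i z]) ->
  (forall n i, (diameter (F n i) <= (b * sqrt2 ^- n)%:E)%E) ->
  (forall e, 0 < e -> exists m, forall n, (m <= n)%N ->
     (size (L n))%:R * (sqrt2 ^- n) `^ t < e) ->
  hausdorff_measure t A = 0%E.
Proof.
move=> t0 b0 AL dF small.
have s2n n : 0 <= sqrt2 ^- n by rewrite invr_ge0 exprn_ge0 // ltW // sqrt2_gt0.
apply/eqP; rewrite eq_le; apply/andP; split; last first.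
  apply: le_trans (hausdorff_premeasure_ge0 t 1 A) _; apply: ereal_sup_ubound.
  by exists 1; [exact: ltr01|].
apply: ge_ereal_sup => _ [delta /= d0 <-]; apply/lee_addgt0Pr => e e0; rewrite add0e.
have bt : 0 <= b `^ t by exact: powR_ge0.
have [m hm] := small (e / (b `^ t + 1)) ltac:(by rewrite divr_gt0 //; lra).
have [m' hm'] := sqrt2V_small (R := R) (e := delta / (b + 1)) ltac:(by rewrite divr_gt0 //; lra).
pose n := maxn m m'.
apply: (le_trans (@hausdorff_premeasure_le_cover _ t delta A (b * sqrt2 ^- n) (L n) (F n) t0 _ _ (AL n) (dF n))).
- by rewrite mulr_ge0.
- have := hm' n (leq_maxr _ _); rewrite ltr_pdivlMr; last lra.
  by have := s2n n; nra.
rewrite lee_fin powRM // mulrCA.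
have := hm n (leq_maxl _ _); rewrite ltr_pdivlMr; last lra.
have : 0 <= (size (L n))%:R * (sqrt2 ^- n) `^ t by rewrite mulr_ge0 // powR_ge0.
by nra.
Qed.

Lemma sqrt2X_powR n (t : R) : (sqrt2 ^- n) `^ t = (sqrt2 `^ t) ^- n.
Proof.
rewrite -(powR_invn _ (ltW sqrt2_gt0)) -powRrM mulrC powRrM powR_invn //.
exact: powR_ge0.
Qed.

(** Chooses the level of the cylinders used to cover a set of diameter D; the error
    eta accounts for the sets of diameter 0. *)
Lemma scale_exists (t D eta : R) : 0 <= t -> 0 <= D -> D <= 1 -> 0 < eta ->
  exists n, D <= sqrt2 ^- n /\ (sqrt2 ^- n) `^ t <= sqrt2 `^ t * D `^ t + eta.
Proof.
move=> t0 D0 D1 eta0.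
have [->|tn] := eqVneq t 0.
  by exists 0%N; rewrite !powRr0 invr1; split=> //; lra.
have tp : 0 < t by rewrite lt_neqAle eq_sym tn.
have [->|Dn] := eqVneq D 0.
  have [m hm] := sqrt2V_small (R := R) (powR_gt0 t^-1 eta0).
  exists m; split; first by rewrite invr_ge0 exprn_ge0 // ltW // sqrt2_gt0.
  rewrite powR0 // mulr0 add0r.
  have -> : eta = (eta `^ t^-1) `^ t by rewrite -powRrM mulVf // powRr1 // ltW.
  apply: ge0_ler_powR => //; rewrite ?nnegrE ?powR_ge0 //.
    by rewrite invr_ge0 exprn_ge0 // ltW // sqrt2_gt0.
  by apply: ltW; apply: hm.
have Dp : 0 < D by rewrite lt_neqAle eq_sym Dn.
have exn : exists n, sqrt2 ^- n.+1 < D.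
  by have [m hm] := sqrt2V_small (R := R) Dp; exists m; apply: hm.
case: (ex_minnP exn) => n hn nmin; exists n; split.
  case: n hn nmin => [|n] _ nmin; first by rewrite invr1.
  by rewrite leNgt; apply/negP => /nmin; rewrite ltnn.
apply: (@le_trans _ _ (sqrt2 `^ t * D `^ t)); last by rewrite lerDl ltW.
rewrite -powRM // ?(ltW sqrt2_gt0) //; apply: ge0_ler_powR => //.
- by rewrite nnegrE invr_ge0 exprn_ge0 // ltW // sqrt2_gt0.
- by rewrite nnegrE mulr_ge0 // ltW // sqrt2_gt0.
have -> : sqrt2 ^- n = sqrt2 * sqrt2 ^- n.+1.
  by rewrite exprS invfM mulrA mulfV ?mul1r // gt_eqF // sqrt2_gt0.
by rewrite ler_wpM2l ?(ltW sqrt2_gt0) // ltW.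
Qed.

(** The limit is the supremum of the lower bounds x n - c / sqrt 2 ^ n. *)
Lemma geometric_cauchy_limit (x : nat -> R) (c : R) : 0 <= c ->
  (forall n k, `|x (n + k)%N - x n| <= c * sqrt2 ^- n) ->
  exists l, forall n, `|l - x n| <= c * sqrt2 ^- n.
Proof.
move=> c0 h; pose S := range (fun n => x n - c * sqrt2 ^- n).
have hub m : ubound S (x m + c * sqrt2 ^- m).
  move=> _ [n _ <-]; have [nm|/ltnW mn] := leqP n m.
    have := h n (m - n)%N; rewrite subnKC // ler_norml => /andP[h1 _].
    have : 0 <= c * sqrt2 ^- m by rewrite mulr_ge0 // invr_ge0 exprn_ge0 // ltW // sqrt2_gt0.
    by lra.
  have := h m (n - m)%N; rewrite subnKC // ler_norml => /andP[_ h1].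
  have : 0 <= c * sqrt2 ^- n by rewrite mulr_ge0 // invr_ge0 exprn_ge0 // ltW // sqrt2_gt0.
  by lra.
have S0 : S !=set0 by exists (x 0%N - c * sqrt2 ^- 0), 0%N.
exists (sup S) => n; rewrite ler_norml; apply/andP; split.
  have : x n - c * sqrt2 ^- n <= sup S.
    apply: ub_le_sup; last by exists n.
    by exists (x 0%N + c * sqrt2 ^- 0); exact: hub.
  by lra.
have : sup S <= x n + c * sqrt2 ^- n by apply: ge_sup => //; exact: hub.
by lra.
Qed.

Lemma normReB_le (z w : R[i]) : `|complex.Re z - complex.Re w| <= N (z - w).
Proof. by have := normRe_le (z - w); case: z w => [a b] [c d]. Qed.

Lemma normImB_le (z w : R[i]) : `|complex.Im z - complex.Im w| <= N (z - w).
Proof. by have := normIm_le (z - w); case: z w => [a b] [c d]. Qed.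

Lemma expansion_exists d : exists z : R[i], expansion d z.
Proof.
pose u n : R[i] := gauss (wordval (mkseq d n)) / alpha R ^+ n.
have an n : alpha R ^+ n != 0 by rewrite expf_neq0 // alpha_neq0.
have tu z n : tail d z n = alpha R ^+ n * (z - u n).
  by rewrite tailE /u; field.
have hu n k : N (u (n + k)%N - u n) <= radius * sqrt2 ^- n.
  have := tail_back d (u (n + k)%N) n k; rewrite !tu subrr mulr0 Normc.normc0 add0r.
  rewrite Normc.normcM normcX normc_alpha mulrN => h.
  rewrite ler_pdivlMr ?exprn_gt0 ?sqrt2_gt0 // mulrC -subr_le0; apply: le_trans h _.
  by rewrite oppr_le0 mulr_ge0 ?invr_ge0 ?exprn_ge0 ?(ltW sqrt2_gt0) ?(ltW radius_gt0).
have [x hx] := @geometric_cauchy_limit (fun n => complex.Re (u n)) radius (ltW radius_gt0)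
  (fun n k => le_trans (normReB_le _ _) (hu n k)).
have [y hy] := @geometric_cauchy_limit (fun n => complex.Im (u n)) radius (ltW radius_gt0)
  (fun n k => le_trans (normImB_le _ _) (hu n k)).
exists (x +i* y); apply: (@bounded_expansion _ _ _ (2 * radius)) => n.
rewrite tu Normc.normcM normcX normc_alpha mulrC -ler_pdivlMr ?exprn_gt0 ?sqrt2_gt0 //.
apply: le_trans (normc_le_ReIm _) _; rewrite -mulrA mulrDl mul1r.
by have := hx n; have := hy n; case: (u n) => a b /= h1 h2; apply: lerD.
Qed.

End HausdorffBounds.

(** * Hausdorff measures of coded sets *)

Section CodedBounds.
Context {R : realType}.
Local Notation N := (@Normc.normc R).
Local Notation sqrt2 := (@sqrt2 R).
Local Notation radius := (@radius R).
Local Notation gauss := (@gauss R).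
Implicit Types (A U : set R[i]^o).

(** Only the first components of the labels are digits of the point. *)
Definition cylinder (n : nat) (w : seq label) : set R[i]^o :=
  [set z : R[i] | N (alpha R ^+ n * z - gauss (wordval [seq e.1 | e <- w])) <= radius].

Lemma diameter_cylinder n w : (diameter (cylinder n w) <= (2 * radius * sqrt2 ^- n)%:E)%E.
Proof.
apply: diameter_le => [|z z' hz hz'].
  by rewrite !mulr_ge0 ?invr_ge0 ?exprn_ge0 ?(ltW sqrt2_gt0) ?(ltW radius_gt0).
rewrite ler_pdivlMr ?exprn_gt0 ?sqrt2_gt0 // mulrC -normc_alpha -normcX -Normc.normcM.
set c := gauss (wordval [seq e.1 | e <- w]) in hz hz'.
have -> : alpha R ^+ n * (z - z') = (alpha R ^+ n * z - c) - (alpha R ^+ n * z' - c).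
  by ring.
by apply: le_trans (normcB_le _ _) _; rewrite mulrDl mul1r lerD.
Qed.

Lemma map_fst_mkseq (e : nat -> label) n :
  [seq x.1 | x <- mkseq e n] = mkseq (fun k => (e k).1) n.
Proof. by rewrite /mkseq -map_comp. Qed.

(** There are O(y ^ n) cylinders of level n, each contributing O(sqrt 2 ^ (- n t)). *)
Lemma coded_measure_eq0 m (I : seq state) A (Q : state -> Prop) (w : state -> R) (y t : R) :
  0 <= t -> 0 < y -> y < sqrt2 `^ t ->
  (forall s, s \in I -> live m s -> Q s) ->
  (forall s e, Q s -> live m (step s e) -> Q (step s e)) ->
  (forall s, Q s -> 1 <= w s) ->
  (forall s, Q s -> transfer step (live m) w s <= y * w s) ->
  (forall z, A z -> exists2 s, s \in I & coded m s z) ->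
  hausdorff_measure t A = 0%E.
Proof.
move=> t0 y0 yt QI Qstep w1 wy AI.
pose L n := flatten [seq live_words step (live m) n s | s <- [seq s <- I | live m s]].
apply: (@hausdorff_measure_eq0 R _ t A L cylinder (2 * radius)) => //.
- by rewrite mulr_ge0 // ltW // radius_gt0.
- move=> n z /AI[s sI [ls [e [pe dz]]]]; exists (mkseq e n).
    apply/flatten_mapP; exists s; first by rewrite mem_filter ls.
    by rewrite mem_live_words size_mkseq eqxx pe.
  by have := dz n; rewrite tailE /cylinder /= map_fst_mkseq.
- by move=> n i; exact: diameter_cylinder.
move=> e e0.
pose C := \sum_(s <- I | live m s) w s.
have C0 : 0 <= C by rewrite /C big_seq_cond sumr_ge0 // => s /andP[sI ls];
  apply: le_trans (w1 _ (QI _ sI ls)).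
have sL n : (size (L n))%:R <= C * y ^+ n.
  rewrite /L size_flatten /shape sumnE !big_map big_filter natr_sum mulr_suml.
  rewrite big_seq_cond [leRHS]big_seq_cond; apply: ler_sum => s /andP[sI ls].
  by rewrite mulrC; apply: (@size_live_words_le _ _ _ _ _ Q) => //; [exact: ltW|exact: QI].
have st : 0 < sqrt2 `^ t by apply: lt_trans yt.
have [M hM] := @expr_small R (y / sqrt2 `^ t) ltac:(by rewrite divr_ge0 ?ltW // ltr_pdivrMr // mul1r)
   (e / (C + 1)) ltac:(by rewrite divr_gt0 //; lra).
exists M => n /hM; rewrite ltr_pdivlMr; last lra.
apply: le_lt_trans; rewrite sqrt2X_powR expr_div_n [leRHS]mulrAC.
rewrite ler_wpM2r ?invr_ge0 ?exprn_ge0 ?(ltW st) //.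
apply: le_trans (sL n) _; rewrite mulrC ler_wpM2l ?exprn_ge0 ?(ltW y0) //.
by rewrite lerDl.
Qed.

(** Replace each set of a cover by the words of the matching level whose cylinders
    meet it; their number is bounded by [live_words_separated], so [mass_cover] bounds
    the sum of the powers of the diameters away from 0. *)
Lemma coded_measure_neq0 m s A (rho t : R) (v : state -> R) :
  0 <= t -> 0 < rho -> sqrt2 `^ t <= rho ->
  subharmonic step (live m) rho v -> 0 < v s -> live m s -> coded m s `<=` A ->
  hausdorff_measure t A <> 0%E.
Proof.
move=> t0 rho0 trho [v0 [B vB] vsub] vs ls sA H0.
have B0 : 0 < B by apply: lt_le_trans vs (vB s).
pose Q : R := (size (box 6) * size neighbours)%:R.
have Q0 : 0 < Q by rewrite ltr0n.
have st0 : 0 < sqrt2 `^ t by rewrite powR_gt0 // sqrt2_gt0.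
(* with this eta, the sum of the powers and the errors of [scale_exists]
   contribute at most a quarter of v s each *)
pose eta := v s / (4 * (B * Q)).
have BQ0 : 0 < B * Q by rewrite mulr_gt0.
have eta0 : 0 < eta by rewrite divr_gt0 // mulr_gt0.
have : (hausdorff_premeasure t 1 A < (eta / sqrt2 `^ t)%:E)%E.
  apply: (@le_lt_trans _ _ 0%E); last by rewrite lte_fin divr_gt0.
  suff : (hausdorff_premeasure t 1 A <= hausdorff_measure t A)%E by rewrite H0.
  by apply: ereal_sup_ubound; exists 1; [exact: ltr01|].
move=> /ereal_inf_lt[_ [U [dU AU] <-]] sumU.
have dfin k : diameter (U k) \is a fin_num.
  by rewrite ge0_fin_numE ?diameter_ge0 //; apply: le_lt_trans (dU k) _; rewrite ltry.
have dU1 k : 0 <= fine (diameter (U k)) <= 1.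
  apply/andP; split; first by rewrite fine_ge0 ?diameter_ge0.
  by rewrite -lee_fin fineK //; exact: dU.
have /choice[n nP] : forall k, exists n, fine (diameter (U k)) <= sqrt2 ^- n /\
    (sqrt2 ^- n) `^ t <= sqrt2 `^ t * fine (diameter (U k)) `^ t + eta / (2 ^ k.+1)%:R.
  move=> k; have /andP[D0 D1] := dU1 k.
  by apply: scale_exists => //; rewrite divr_gt0 // ltr0n expn_gt0.
pose V k : pred (seq label) := fun w => `[< exists e : nat -> label,
   [/\ w = mkseq e (n k), live_path step (live m) s e &
       exists2 z : R[i], U k z & expansion (fun j => (e j).1) z] >].
have := mass_cover (n := n) (V := V) v0 rho0 vsub ls.
have cov e : live_path step (live m) s e -> exists k, V k (mkseq e (n k)).
  move=> pe; have [z dz] := expansion_exists (R := R) (fun j => (e j).1).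
  have [k _ Uz] : (\bigcup_k U k) (z : R[i]^o) by apply/AU/sA; split=> //; exists e.
  by exists k; apply/asboolP; exists e; split=> //; exists z.
move=> /(_ cov); apply/negP; rewrite -ltNge.
have cnt k : (count (V k) (live_words step (live m) (n k) s))%:R <= Q.
  rewrite ler_nat -size_filter; apply: (@live_words_separated R m s (n k)) => //.
  - by rewrite filter_uniq // live_words_uniq.
  - by move=> w; rewrite mem_filter mem_live_words => /and3P[_ /eqP].
  move=> w w'; rewrite !mem_filter => /andP[/asboolP[e [-> _ [z Uz dz]]] _].
  move=> /andP[/asboolP[e' [-> _ [z' Uz' dz']]] _].
  rewrite !map_fst_mkseq; have := dz (n k); have := dz' (n k); rewrite !tailE.
  set a := gauss _; set a' := gauss _ => h' h.
  have hz : N (alpha R ^+ n k * (z - z')) <= 1.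
    rewrite Normc.normcM normcX normc_alpha mulrC -ler_pdivlMr ?exprn_gt0 ?sqrt2_gt0 // mul1r.
    by apply: le_trans (normc_le_diameter (dU k) Uz Uz') _; case: (nP k).
  have -> : a' - a = - (alpha R ^+ n k * z - a') + (alpha R ^+ n k * (z - z')
               + (alpha R ^+ n k * z' - a)) by ring.
  apply: le_trans (normcD_le _ _) _; rewrite normcN.
  have := normcD_le (alpha R ^+ n k * (z - z')) (alpha R ^+ n k * z' - a).
  by have := @radius_lt R; lra.
have massU k : ((mass step (live m) v rho s (n k) (V k))%:E <=
    (B * Q * sqrt2 `^ t)%:E * diameter_pow t (U k) + (B * Q * eta / (2 ^ k.+1)%:R)%:E)%E.
  have [nP1 nP2] := nP k.
  have eta_k : 0 <= B * Q * eta / (2 ^ k.+1)%:R.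
    by rewrite divr_ge0 // ltW // mulr_gt0.
  rewrite /diameter_pow; case: asboolP => Uk.
    rewrite mule0 add0e lee_fin; apply: le_trans eta_k.
    apply: le_trans (mass_le _ _ rho0 _ _ _ vB) _.
    rewrite (@eq_count _ _ pred0) ?count_pred0 ?mulr0 // => w.
    by apply/negbTE/negP => /asboolP[e [_ _ [z]]]; rewrite Uk.
  rewrite -[diameter (U k)]fineK // poweR_EFin -!EFinM -EFinD lee_fin.
  apply: le_trans (mass_le _ _ rho0 _ _ _ vB) _.
  apply: (@le_trans _ _ ((sqrt2 ^- n k) `^ t * (B * Q))).
    apply: ler_pM; rewrite ?invr_ge0 ?exprn_ge0 ?(ltW rho0) ?mulr_ge0 ?(ltW B0) //.
      rewrite sqrt2X_powR lef_pV2 ?posrE ?exprn_gt0 //.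
      by apply: lerXn2r; rewrite ?nnegrE // ltW.
    by rewrite ler_wpM2l // ltW.
  apply: le_trans (ler_wpM2r (ltW BQ0) nP2) _.
  by rewrite le_eqVlt; apply/orP; left; apply/eqP; field; rewrite pnatr_eq0 expn_eq0.
apply: le_lt_trans (lee_nneseries _ (fun k _ => massU k)) _.
  by move=> k _ _; rewrite lee_fin; exact: mass_ge0.
apply: le_lt_trans (epsilon_trick _ _ _) _.
- by move=> k; rewrite mule_ge0 ?diameter_pow_ge0 // lee_fin ltW // mulr_gt0.
- by rewrite ltW // mulr_gt0.
rewrite nneseriesZl; last by move=> *; exact: diameter_pow_ge0.
apply: (@le_lt_trans _ _ ((B * Q * sqrt2 `^ t)%:E * (eta / sqrt2 `^ t)%:E + (B * Q * eta)%:E)%E).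
  apply: leeD2r; apply: lee_wpmul2l; last exact: ltW.
  by rewrite lee_fin ltW // mulr_gt0.
rewrite -EFinM -EFinD lte_fin.
have -> : B * Q * sqrt2 `^ t * (eta / sqrt2 `^ t) + B * Q * eta = v s / 2.
  by rewrite /eta; field; rewrite !gt_eqF.
by lra.
Qed.

End CodedBounds.

(** * Dimensions of the slices and of the boundary *)

Section Spectral.
Context {R : realType}.
Variables (T : choiceType) (E : finType) (step : T -> E -> T) (live : pred T).
Variables (states I : seq T).
Hypothesis live_states : forall s, live s -> s \in states.

Definition reachable (s : T) : Prop :=
  live s /\ exists i w, [/\ i \in I, live i, live_word step live i w & s = foldl step i w].

Lemma reachable_step s e : reachable s -> live (step s e) -> reachable (step s e).
Proof.
move=> [ls [i [w [iI li lw sE]]]] le; split=> //; exists i, (rcons w e).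
by rewrite live_word_rcons foldl_rcons -sE lw.
Qed.

Let S := seq_sub [seq s <- states | `[< reachable s >]].
Let n := #|{: S}|.
Let st (i : 'I_n) : T := ssval (enum_val i).

Let st_reachable i : reachable (st i).
Proof. by have := ssvalP (enum_val i); rewrite mem_filter => /andP[/asboolP]. Qed.

Let st_surj s : reachable s -> exists i, st i = s.
Proof.
move=> rs; have sS : s \in [seq s <- states | `[< reachable s >]].
  by rewrite mem_filter; apply/andP; split; [exact/asboolP|apply: live_states; case: rs].
by exists (enum_rank (SeqSub sS : S)); rewrite /st enum_rankK.
Qed.

Let st_inj : injective st.
Proof. by move=> i j /val_inj/enum_val_inj. Qed.

Definition step_matrix : 'M[int]_n :=
  \matrix_(i, j) \sum_e (step (st i) e == st j)%:R.

Let ext (u : 'cV[R]_n) (s : T) : R := \sum_j (s == st j)%:R * u j 0.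

Let ext_st u i : ext u (st i) = u i 0.
Proof.
rewrite /ext (bigD1 i) //= eqxx mul1r big1 ?addr0 // => j ji.
by rewrite (inj_eq st_inj) eq_sym (negPf ji) mul0r.
Qed.

Let transfer_ext u i :
  transfer step live (ext u) (st i) = (map_mx intr step_matrix *m u) i 0.
Proof.
rewrite mxE /transfer big_mkcond /=.
transitivity (\sum_e \sum_j (step (st i) e == st j)%:R * u j 0).
  apply: eq_bigr => e _; case: ifPn => // nle; rewrite big1 // => j _.
  case: eqP => [sj|]; last by rewrite mul0r.
  by move: nle; rewrite sj; case: (st_reachable j) => ->.
rewrite exchange_big; apply: eq_bigr => j _; rewrite !mxE rmorph_sum mulr_suml.
by apply: eq_bigr => e _; rewrite /= natz.
Qed.

(** The matrix is restricted to the states reachable from I: components that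
    cannot be reached may grow faster.  Conversely all its states are reached, so the
    subharmonic vector can be made positive at a state of I. *)
Lemma growth_rate : (exists2 s, s \in I & live s) -> exists rho : R, [/\ 0 <= rho,
   exists k (B : 'M[int]_k) (x : 'cV[R]_k), x != 0 /\ map_mx intr B *m x = rho *: x,
   exists s v, [/\ s \in I, live s, subharmonic step live rho v & 0 < v s]
 & forall y, rho < y -> exists w : T -> R, (forall s, reachable s -> 1 <= w s) /\
     forall s, reachable s -> transfer step live w s <= y * w s].
Proof.
move=> [s0 s0I ls0].
have rs0 : reachable s0 by split=> //; exists s0, [::].
have [i0 _] := st_surj rs0.
have A0 i j : 0 <= map_mx intr step_matrix i j :> R.
  by rewrite !mxE ler0z sumr_ge0.
have [rho [rho0 [x x0 Ax] sup]] := perron i0 A0; exists rho; split=> //.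
- by exists n, step_matrix, x.
- pose a : 'cV[R]_n := \col_i `|x i 0|.
  have [j xj] : exists j, x j 0 != 0.
    apply: contrapT => /forallNP h; move/eqP: x0; apply; apply/matrixP => i k.
    by rewrite (ord1 k) mxE; apply/eqP/negPn/negP/h.
  have asub : subharmonic step live rho (ext a).
    have a0 i : 0 <= a i 0 by rewrite mxE.
    have e0 s : 0 <= ext a s by apply: sumr_ge0 => i _; rewrite mulr_ge0.
    split=> //.
      exists (\sum_j a j 0) => s; apply: ler_sum => i _.
      by case: eqP => _; rewrite ?mul1r ?mul0r.
    move=> s ls; have [rs|nrs] := pselect (reachable s); last first.
      rewrite [ext a s]big1 ?mulr0 ?transfer_ge0 // => i _.
      by case: eqP => [si|]; rewrite ?mul0r //; case: nrs; rewrite si.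
    have [i <-] := st_surj rs; rewrite transfer_ext ext_st.
    have := congr1 (fun M : 'cV[R]_n => M i 0) Ax; rewrite !mxE => Axi.
    rewrite -[X in X * _]ger0_norm // -normrM -Axi.
    apply: le_trans (ler_norm_sum _ _ _) _; apply: ler_sum => l _.
    by rewrite normrM ger0_norm // !mxE.
  have [_ [i [w [iI li lw jE]]]] := st_reachable j.
  have [|v vsub vi] := @subharmonic_pull R _ _ step live rho i w lw; last by exists i, v.
  exists (ext a); first exact: asub.
  by rewrite -jE ext_st mxE normr_gt0.
move=> y /sup[w w1 Aw]; exists (ext w); split=> s rs.
  by have [i <-] := st_surj rs; rewrite ext_st.
by have [i <-] := st_surj rs; rewrite transfer_ext ext_st.
Qed.
End Spectral.

Section Dimension.
Context {R : realType}.
Local Notation sqrt2 := (@sqrt2 R).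

Lemma ln_sqrt2_gt0 : 0 < ln sqrt2.
Proof. by rewrite ln_gt0 // sqrt2_gt1. Qed.

Lemma sqrt2_powRE t : sqrt2 `^ t = expR (t * ln sqrt2).
Proof. by rewrite /powR gt_eqF // sqrt2_gt0. Qed.

(** The hypothesis 1 < rho exempts the dimension 0 from the lower bound, and with it
    the empty set. *)
Lemma hausdorff_dimE (A : set R[i]^o) (rho : R) : 1 <= rho ->
  (forall t, 0 <= t -> rho < sqrt2 `^ t -> hausdorff_measure t A = 0%E) ->
  (1 < rho -> forall t, 0 <= t -> sqrt2 `^ t <= rho -> hausdorff_measure t A <> 0%E) ->
  hausdorff_dim A = (ln rho / ln sqrt2)%:E.
Proof.
move=> rho1 up low; set sig := ln rho / ln sqrt2.
have ls := ln_sqrt2_gt0.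
have rho0 : 0 < rho by lra.
have sig0 : 0 <= sig by apply: divr_ge0; [exact: ln_ge0|exact: ltW].
have rhoE : rho = expR (sig * ln sqrt2) by rewrite divfK ?gt_eqF // lnK // posrE.
apply/eqP; rewrite eq_le; apply/andP; split.
  apply/lee_addgt0Pr => e e0; apply: ereal_inf_lbound; exists (sig + e) => //.
  split; first by lra.
  apply: up; first by lra.
  by rewrite sqrt2_powRE rhoE ltr_expR ltr_pM2r // ltrDl.
apply: le_ereal_inf_tmp => _ [t [t0 Ht] <-]; rewrite lee_fin leNgt; apply/negP => ts.
have r1 : 1 < rho.
  rewrite lt_neqAle rho1 andbT; apply/eqP => r1.
  by move: ts; rewrite /sig -r1 ln1 mul0r; lra.
apply: (low r1 t) => //.
by rewrite sqrt2_powRE rhoE ler_expR ler_pM2r // ltW.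
Qed.

(** Integrality is expressed by matrices rather than polynomials, because squaring
    the eigenvalue is then squaring the matrix. *)
Definition integer_eigenvalue (rho : R) :=
  exists k (B : 'M[int]_k) (x : 'cV[R]_k), x != 0 /\ map_mx intr B *m x = rho *: x.

(** When no infinite path starts in I, or when the growth rate is below 1, the
    dimension is 0 and rho = 1 serves. *)
Lemma coded_dim m (I : seq state) (A : set R[i]^o) :
  (forall z, A z <-> exists2 s, s \in I & coded m s z) ->
  exists rho : R, [/\ 1 <= rho, integer_eigenvalue rho &
     hausdorff_dim A = (ln rho / ln sqrt2)%:E].
Proof.
move=> AI.
have eig1 : integer_eigenvalue 1.
  exists 1%N, 1%:M, 1%:M; rewrite oner_neq0; split=> //.
  by rewrite map_mx1 mul1mx scale1r.
have [[s sI ls]|nI] := pselect (exists2 s, s \in I & live m s); last first.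
  exists 1; split=> //; apply: hausdorff_dimE => // [t t0 _|]; last by rewrite ltxx.
  apply: (@hausdorff_measure_eq0 R state t A (fun=> [::]) (fun _ _ => set0) 0) => //.
  - by move=> n z /AI[s sI [ls _]]; case: nI; exists s.
  - by move=> n i; rewrite mul0r; apply: diameter_le.
  - by move=> e e0; exists 0%N => n _; rewrite mul0r.
have [rho [rho0 eig [i [v [iI li vsub vi]]] sup]] :=
  @growth_rate R _ _ step (live m) (live_states m) I (@mem_live_states m)
    (ex_intro2 _ _ s sI ls).
have up t : 0 <= t -> rho < sqrt2 `^ t -> hausdorff_measure t A = 0%E.
  move=> t0 rt; pose y := (rho + sqrt2 `^ t) / 2.
  have [|w [w1 wy]] := sup y; first by rewrite /y; lra.
  apply: (@coded_measure_eq0 R m I A (reachable step (live m) I) w y) => //.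
  - by rewrite /y; lra.
  - by rewrite /y; lra.
  - by move=> s' sI' ls'; split=> //; exists s', [::].
  - by move=> s' e; apply: reachable_step.
  - by move=> z /AI.
have [r1|r1] := leP 1 rho.
  exists rho; split=> //; apply: hausdorff_dimE => // _ t t0 tr.
  apply: (@coded_measure_neq0 R m i A rho t v) => //; first lra.
  by move=> z cz; apply/AI; exists i.
exists 1; split=> //; apply: hausdorff_dimE => // [t t0 t1|]; last by rewrite ltxx.
by apply: up => //; apply: lt_trans t1.
Qed.

Definition starts (p q r : int) : seq state := [seq start p q r g | g <- neighbours].

Lemma slice_starts (p q r : int) (z : R[i]) :
  (boundary (twin_dragon R) `&` line R p q r) z <->
  exists2 s, s \in starts p q r & coded (absz p + absz q) s z.
Proof.
split=> [/slice_coded[g gn cz]|[_ /mapP[g gn ->] cz]].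
  by exists (start p q r g) => //; apply: map_f.
by apply/slice_coded; exists g.
Qed.

Lemma lambda_exists : exists2 l : R, 1 < l & l ^+ 3 = l ^+ 2 + 2.
Proof.
pose p : {poly R} := 'X^3 - 'X^2 - 2%:P.
have pE x : p.[x] = x ^+ 3 - x ^+ 2 - 2 by rewrite !hornerE.
have [||l /andP[l1 l2] /rootP] := @poly_ivt R p 1 2; rewrite ?pE; try lra.
move=> h; exists l; last by lra.
by rewrite lt_neqAle l1 andbT; apply/eqP => l0; move: h; rewrite -l0; lra.
Qed.

Definition dragon_vector (l : R) (s : state) : R :=
  let g := s.1.1.1 in
  if g.1 == 0 then l ^+ 2 else if g.2 == 0 then l else 1.

(** Up to sign, (1, 1) leads to (1, 0), which leads to (0, 1), which leads once to
    (0, 1) and twice to (1, 1); the last equation is l ^ 3 = l ^ 2 + 2. *)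
Lemma dragon_vector_eigen l s : l ^+ 3 = l ^+ 2 + 2 -> live 0 s ->
  transfer step (live 0) (dragon_vector l) s = l * dragon_vector l s.
Proof.
move=> hl; case: s => [[[g b] [p q]] r].
rewrite /live /= leqn0 addn_eq0 !absz_eq0 muln0 leqn0 absz_eq0.
move=> /and3P[gn /andP[/eqP-> /eqP->] /eqP->].
rewrite /transfer big_mkcond -(pair_bigA _ (fun x y => if live 0 (step (g, b, (0, 0), 0) (x, y))
  then dragon_vector l (step (g, b, (0, 0), 0) (x, y)) else 0)) /= !big_bool.
have lE e : live 0 (step (g, b, (0, 0), 0) e) = (gstep g e \in neighbours).
  by case: e => [[] []]; case: (b); rewrite /live /step /= andbT.
have vE e : dragon_vector l (step (g, b, (0, 0), 0) e) =
  if (gstep g e).1 == 0 then l ^+ 2 else if (gstep g e).2 == 0 then l else 1.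
  by rewrite /dragon_vector step_g.
rewrite !lE !vE /dragon_vector /=.
move: gn; rewrite !inE => /or4P[/eqP->|/eqP->|/eqP->|/or3P[/eqP->|/eqP->|/eqP->]] /=;
 rewrite /gstep /digit /mulalpha /= ?(addr0, add0r); lra.
Qed.

Lemma boundary_dim l : 1 < l -> l ^+ 3 = l ^+ 2 + 2 ->
  hausdorff_dim (boundary (twin_dragon R)) = (ln l / ln sqrt2)%:E.
Proof.
move=> l1 hl; pose A := boundary (twin_dragon R).
have AI (z : R[i]) : A z <-> exists2 s, s \in starts 0 0 0 & coded 0 s z.
  rewrite -(slice_starts 0 0 0); split=> [Az|[]//]; split=> //.
  by rewrite /line /= !mul0r addr0.
have v1 s : 1 <= dragon_vector l s <= l ^+ 2.
  by rewrite /dragon_vector; case: ifP => _; [|case: ifP => _]; apply/andP; split; nra.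
apply: hausdorff_dimE; first exact: ltW.
  move=> t t0 lt; apply: (@coded_measure_eq0 R 0 (starts 0 0 0) A (live 0) (dragon_vector l) l) => //; first lra.
  - by move=> s _; case/andP: (v1 s).
  - by move=> s ls; rewrite dragon_vector_eigen.
  - by move=> z /AI.
move=> _ t t0 tl; pose s := start 0 0 0 (1, 0).
apply: (@coded_measure_neq0 R 0 s A l t (dragon_vector l)) => //; first lra.
- split=> [s'||s' ls'].
  + by case/andP: (v1 s') => ? _; lra.
  + by exists (l ^+ 2) => s'; case/andP: (v1 s').
  + by rewrite dragon_vector_eigen.
- by case/andP: (v1 s) => ? _; lra.
- by move=> z cz; apply/AI; exists s.
Qed.
End Dimension.

Theorem theorem2p5 (R : realType) (p q r : int) :
  hausdorff_dim (boundary (twin_dragon R) `&` line R p q r) <>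
  (hausdorff_dim (boundary (twin_dragon R)) - 1)%E.
Proof.
have [l l1 hl] := @lambda_exists R.
have [rho [rho1 [k [B [x [x0 Bx]]]] ->]] :=
  @coded_dim R _ (starts p q r) _ (slice_starts p q r).
rewrite (boundary_dim l1 hl) -EFinB => -[E].
have ls := @ln_sqrt2_gt0 R.
have s0 := @sqrt2_gt0 R.
have lE : l = rho * sqrt2.
  apply: ln_inj; rewrite ?posrE ?mulr_gt0 //; try lra.
  rewrite lnM ?posrE //; last lra.
  have := congr1 (fun u => u * ln sqrt2) E.
  by rewrite mulrBl !divfK ?gt_eqF // mul1r => ->; rewrite subrK.
have mu2 : 2 * rho ^+ 2 = l ^+ 2 by rewrite lE exprMn sqrt2_sqr mulrC.
(* rho ^ 2 = l ^ 2 / 2 is the root mu of the cubic polynomial *)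
have mu0 : 2 * (rho ^+ 2) ^+ 3 - (rho ^+ 2) ^+ 2 - 2 * rho ^+ 2 - 1 = 0.
  set mu := rho ^+ 2 in mu2 *.
  have h1 : l * mu = mu + 1 by move: hl; rewrite exprS -mu2 => hl; nra.
  have : (l * mu) ^+ 2 = (mu + 1) ^+ 2 by rewrite h1.
  by rewrite exprMn -mu2 => h2; nra.
apply: (negP (half_square_not_eigenvalue (B *m B) mu0 x0)); apply/eqP.
by rewrite map_mxM -mulmxA Bx -scalemxAr Bx scalerA.
Qed.
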